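(* Let $\Gamma$ be a metric graph, let $D$ be a divisor on $\Gamma$, and let $G=(V,E)$ be a combinatorial graph underlying $\Gamma$ (that is, a model of $\Gamma$) such that $D$ is supported on $V$. For each integer $r\geq 0$, there are finitely many combinatorial subdivisions $H_1,\dots,H_k$ of $G$ and finitely many slope structures $\mathfrak S_1,\dots,\mathfrak S_k$ of width $r$, with $\mathfrak S_j$ defined on the graph $H_j$, such that for every admissible semimodule $M\subset\mathrm{Rat}(D)$ of rank $r$ with underlying slope structure $\mathfrak S$, there is an index $j\in\{1,\dots,k\}$ such that $H_j$ is a combinatorial model of $\Gamma$ on which $\mathfrak S$ is defined and $\mathfrak S=\mathfrak S_j$; that is, for a suitable choice of the positions in $\Gamma$ of the subdivision vertices of $H_j$, $\mathfrak S$ is the slope structure on $\Gamma$ induced by $\mathfrak S_j$.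
   Context: Metric graphs. A metric graph $\Gamma$ is the metric realization of a pair $(G,\ell)$, where $G=(V,E)$ is a finite connected graph with at least one edge and $\ell\colon E\to\mathbb R_{>0}$: each edge $e$ is replaced by a closed interval of length $\ell(e)$, glued according to $G$, with the path metric. $G$ (with $\ell$) is called a model of $\Gamma$; a model is simple if it has no loops and no parallel edges. $\mathrm T_x(\Gamma)$ is the finite set of outgoing unit tangent vectors at $x$, and $d_x=|\mathrm T_x(\Gamma)|$. $\mathrm{Rat}(\Gamma)$ is the set of continuous piecewise affine functions $f\colon\Gamma\to\mathbb R$ with integral slopes; $\mathrm{slope}_\nu(f)$ is the outgoing slope of $f$ along $\nu$. A divisor $D$ is a finite formal integer combination of points of $\Gamma$, $D(x)$ is its coefficient at $x$, $D\ge 0$ (effective) means all coefficients are $\geq 0$. $\mathrm{div}(f)=\sum_x \mathrm{ord}_x(f)(x)$ with $\mathrm{ord}_x(f)=-\sum_{\nu\in \mathrm T_x(\Gamma)}\mathrm{slope}_\nu(f)$. $\mathrm{Rat}(D)=\{f\in\mathrm{Rat}(\Gamma): D+\mathrm{div}(f)\ge 0\}$. A combinatorial subdivision of $G$ is an abstract graph obtained by replacing each edge of $G$ by a path; placing its new vertices in the interiors of the corresponding edges of $\Gamma$, in the prescribed order and at any distinct positions, makes it a model of $\Gamma$. Hypercube rank functions. Put $[r]=\{0,\dots,r\}$. The hypercube $[r]^\delta$ ($\delta\geq 1$) carries the coordinatewise order $\preceq$ and coordinatewise max $\vee$ and min $\wedge$; $\underline e_i$ is the $i$-th unit vector. A rank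 function is a map $\rho\colon[r]^\delta\to\mathbb Z$ such that: (1) $\rho(t\,\underline e_i)=r-t$ for all $i$ and $t\in[r]$; (2) $\underline a\preceq\underline b$ implies $\rho(\underline b)\le\rho(\underline a)$; (3) $\rho(\underline a)+\rho(\underline b)\le\rho(\underline a\vee\underline b)+\rho(\underline a\wedge\underline b)$; (4) $\rho$ takes values in $\{-1,0,\dots,r\}$. A jump of $\rho$ is a point $\underline a$ with $\rho(\underline a)\ge 0$ and $\rho(\underline a+\underline e_i)=\rho(\underline a)-1$ for every $i$ with $\underline a+\underline e_i\in[r]^\delta$. The standard rank function is $\rho(\underline a)=\max\{-1,r-a_1-\dots-a_\delta\}$. Slope structures. A slope structure of width $r$ on a simple graph $H=(V',E')$ is the data of: for every oriented edge $uv$, a set $S^{uv}$ of integers $s_0^{uv}<\dots<s_r^{uv}$ with $s_i^{uv}+s_{r-i}^{vu}=0$; for every $v\in V'$, a rank function $\rho_v$ on $[r]^{d_v}$ ($d_v$ the valence of $v$), whose coordinates are indexed by the oriented edges with tail $v$. A slope structure $\mathfrak S$ of width $r$ on $\Gamma$ is one induced from some simple graph model $H$ of $\Gamma$ (one then says that $\mathfrak S$ is defined on $H$) as follows: for $x\in\Gamma$, $\nu\in \mathrm T_x(\Gamma)$, $S^\nu=\{s_0^\nu<\dots<s_r^\nu\}$ is $S^{uv}$ for the oriented edge $uv$ of $H$ parallel to $\nu$; for $x\in\Gamma\setminus V'$, $\rho_x$ is the standard rank function on $[r]^2$. Two slope structures on $\Gamma$ are equal if all sets $S^\nu$ and rank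 functions $\rho_x$ agree. For $\underline a=(a_\nu)_\nu\in[r]^{\mathrm T_x(\Gamma)}$ put $s_{\underline a}=(s^\nu_{a_\nu})_\nu$, and let $S^x=\{s_{\underline a}:\underline a\text{ a jump of }\rho_x\}$. A function $f\in\mathrm{Rat}(\Gamma)$ is compatible with $\mathfrak S$ if for every $x\in\Gamma$, $\mathrm{slope}_\nu(f)\in S^\nu$ for all $\nu\in\mathrm T_x(\Gamma)$, and $\partial_x(f):=(\mathrm{slope}_\nu(f))_{\nu\in \mathrm T_x(\Gamma)}\in S^x$. If $\partial_x(f)=s_{\underline a}$, write $\rho_x(\partial_x(f)):=\rho_x(\underline a)$. $\mathrm{Rat}(D,\mathfrak S)$ is the set of $f\in\mathrm{Rat}(D)$ compatible with $\mathfrak S$. Admissible semimodules. A semimodule is a subset of $\mathrm{Rat}(\Gamma)$ stable under $(f,g)\mapsto\min(f,g)$ and $f\mapsto f+c$, $c\in\mathbb R$. A semimodule $M\subseteq\mathrm{Rat}(D)$ is admissible of rank $r$, with underlying slope structure $\mathfrak S$, if it is closed for the topology of $\|\cdot\|_\infty$, $\mathfrak S$ is a slope structure of width $r$ on $\Gamma$ with $M\subseteq\mathrm{Rat}(D,\mathfrak S)$, and for every effective divisor $E$ of degree $r$ there is $f\in M$ with $\rho_x(\partial_x(f))\ge E(x)$ for all $x\in\Gamma$ and $D+\mathrm{div}(f)-E\ge 0$. *)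

(* Defs.v *)
From HB Require Import structures.
From mathcomp Require Import all_boot all_order all_algebra finmap.
From mathcomp Require Import boolp classical_sets reals.

Set Implicit Arguments.
Unset Strict Implicit.
Unset Printing Implicit Defensive.

Import Order.TTheory GRing.Theory Num.Theory.
Local Open Scope ring_scope.

(** * Finite graphs (loops and parallel edges allowed) *)

Record graph := Graph {
  vertex : finType;
  edge : finType;
  src : edge -> vertex;
  tgt : edge -> vertex
}.

Section Graphs.
Variable G : graph.

(* [(e, true)] is [e] oriented from [src e] to [tgt e]; [(e, false)] is the
   opposite orientation.  A loop has two distinct orientations. *)
Definition oedge := (edge G * bool)%type.

Definition osrc (h : oedge) := if h.2 then src h.1 else tgt h.1.
Definition otgt (h : oedge) := if h.2 then tgt h.1 else src h.1.
Definition orev (h : oedge) : oedge := (h.1, ~~ h.2).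

Definition star (v : vertex G) := {h : oedge | osrc h == v}.

Definition connected_graph :=
  forall u v : vertex G,
    connect (fun x y => [exists h : oedge, (osrc h == x) && (otgt h == y)]) u v.

Definition simple_graph :=
  (forall e : edge G, src e != tgt e) /\
  (forall h h' : oedge, osrc h = osrc h' -> otgt h = otgt h' -> h = h').

End Graphs.

(* The edge [e] is replaced by the path with [(n e).+1] edges
   [Tagged e 0, ..., Tagged e (n e)] from [src e] to [tgt e]; its inner vertices
   are [Tagged e 0, ..., Tagged e (n e).-1], and the vertex [Tagged e j] lies
   between the edges [Tagged e j] and [Tagged e j.+1]. *)
Definition subdivision (G : graph) (n : edge G -> nat) : graph :=
  @Graph (vertex G + {e : edge G & 'I_(n e)})%type
    {e : edge G & 'I_(n e).+1}
    (fun f => if unlift ord0 (tagged f) is Some j then inr (Tagged _ j)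
              else inl (src (tag f)))
    (fun f => if unlift ord_max (tagged f) is Some j then inr (Tagged _ j)
              else inl (tgt (tag f))).

(** * Metric graphs *)

Definition knots (R : realType) (a b : R) (k : nat) (t : nat -> R) :=
  [/\ t 0%N = a, t k = b & forall i, (i < k)%N -> t i < t i.+1].

Section MetricGraph.
Variables (R : realType) (G : graph) (l : edge G -> R).

Definition metric_graph :=
  [/\ connected_graph G, inhabited (edge G) & forall e, 0 < l e].

(* Vertices, and points at distance [t] from [src e] inside an edge [e]. *)
Definition realization :=
  (vertex G + {p : edge G * R | (0 < p.2) && (p.2 < l p.1)})%type.

Definition pt (e : edge G) (t : R) : realization :=
  if insub (e, t) is Some p then inr p
  else inl (if t <= 0 then src e else tgt e).

Inductive walk : realization -> realization -> R -> Prop :=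
| walk_nil x : walk x x 0
| walk_cons x y e a b L :
    0 <= a <= l e -> 0 <= b <= l e -> x = pt e a -> walk (pt e b) y L ->
    walk x y (`|a - b| + L).

(* The path metric. *)
Definition dist (x y : realization) : R := inf [set L | walk x y L]%classic.

(* A unit tangent vector at [x] is given by the oriented edge along which it
   points: at a vertex the edge leaves [x], inside an edge it is one of the two
   orientations of that edge. *)
Definition outgoing (x : realization) (h : oedge G) : bool :=
  match x with
  | inl v => osrc h == v
  | inr p => h.1 == (val p).1
  end.

Definition tangent (x : realization) := {h : oedge G | outgoing x h}.

Definition along (h : oedge G) (u : R) : realization :=
  pt h.1 (if h.2 then u else l h.1 - u).

(* Distance from the origin of [h] to [x] along [h]. *)
Definition offset (x : realization) (h : oedge G) : R :=
  match x with
  | inl _ => 0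
  | inr p => if h.2 then (val p).2 else l h.1 - (val p).2
  end.

(* The point at (small) distance [s] from [x] in the direction [nu]. *)
Definition travel (x : realization) (nu : tangent x) (s : R) : realization :=
  along (val nu) (offset x (val nu) + s).

Definition slope (f : realization -> R) (x : realization) (nu : tangent x) :
    int :=
  xget 0 [set m : int | exists2 eps : R, 0 < eps &
    forall s, 0 <= s < eps -> f (travel nu s) = f x + m%:~R * s]%classic.

(* [Rat(Gamma)]; continuity holds because the affine pieces are closed. *)
Definition RatFun : set (realization -> R) :=
  [set f | forall e, exists (k : nat) (t : nat -> R) (m : nat -> int),
    knots 0 (l e) k t /\
    forall i u, (i < k)%N -> t i <= u <= t i.+1 ->
      f (pt e u) = f (pt e (t i)) + (m i)%:~R * (u - t i)]%classic.

Definition ord_at (f : realization -> R) (x : realization) : int :=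
  - \sum_(nu : tangent x) slope f nu.

Definition divisor := {fsfun realization -> int with 0}.

Definition degree (E : divisor) : int := \sum_(x <- finsupp E) E x.
Definition effective (E : divisor) := forall x, 0 <= E x.
Definition supported_on_vertices (D : divisor) :=
  forall x, D x != 0 -> exists v, x = inl v.

Definition RatD (D : divisor) : set (realization -> R) :=
  [set f | RatFun f /\ forall x, 0 <= D x + ord_at f x]%classic.

End MetricGraph.

(** * Rank functions on hypercubes *)

Section RankFunctions.
Variables (r : nat) (I : finType).
Local Notation cube := {ffun I -> 'I_r.+1}.

Definition axis (i : I) (t : 'I_r.+1) : cube :=
  [ffun j => if j == i then t else ord0].
Definition cube_le (a b : cube) := forall i, (a i <= b i)%N.
Definition cube_max (a b : cube) : cube :=
  [ffun i => if (a i <= b i)%N then b i else a i].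
Definition cube_min (a b : cube) : cube :=
  [ffun i => if (a i <= b i)%N then a i else b i].
(* [a + e_i]; only meaningful when [a i < r]. *)
Definition cube_succ (a : cube) (i : I) : cube :=
  [ffun j => if j == i then inord (a i).+1 else a j].

Definition rank_function (rho : cube -> int) :=
  [/\ forall i (t : 'I_r.+1), rho (axis i t) = r%:Z - t%:Z,
      forall a b, cube_le a b -> rho b <= rho a,
      forall a b, rho a + rho b <= rho (cube_max a b) + rho (cube_min a b)
    & forall a, -1 <= rho a <= r%:Z].

Definition jump (rho : cube -> int) (a : cube) :=
  0 <= rho a /\
  forall i, (a i < r)%N -> rho (cube_succ a i) = rho a - 1.

Definition standard_rank (a : cube) : int :=
  Num.max (-1) (r%:Z - \sum_i (a i)%:Z).

End RankFunctions.

(** * Slope structures *)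

(* [slopes h i] is the slope [s_i] of the oriented edge [h]. *)
Record slope_structure (r : nat) (H : graph) := SlopeStructure {
  slopes : oedge H -> 'I_r.+1 -> int;
  rank : forall v : vertex H, {ffun star v -> 'I_r.+1} -> int;
  _ : simple_graph H;
  _ : forall h (i j : 'I_r.+1), (i < j)%N -> slopes h i < slopes h j;
  _ : forall h i, slopes h i + slopes (orev h) (rev_ord i) = 0;
  _ : forall v, rank_function (rank (v := v))
}.

(* [(H, lH)] is a model of the realization of [(G, l)], via [phi]. *)
Definition is_model (R : realType) (H G : graph)
    (lH : edge H -> R) (l : edge G -> R)
    (phi : realization lH -> realization l) :=
  [/\ metric_graph lH, bijective phi
    & forall x y, dist (phi x) (phi y) = dist x y].

Section MetricSlopeStructure.
Variables (R : realType) (G : graph) (l : edge G -> R) (r : nat).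

(* The sets [S^nu] (by their increasing enumerations) and the functions
   [rho_x]; the conditions on them are in [is_slope_structure]. *)
Record slope_data := SlopeData {
  mslopes : forall x : realization l, tangent x -> 'I_r.+1 -> int;
  mrank : forall x : realization l, {ffun tangent x -> 'I_r.+1} -> int
}.

Section Induced.
Variables (H : graph) (lH : edge H -> R) (phi : realization lH -> realization l).

Definition parallel (y : realization lH) (h : tangent y)
    (nu : tangent (phi y)) :=
  exists2 eps : R, 0 < eps &
    forall s, 0 <= s < eps -> phi (travel h s) = travel nu s.

(* [SS] is the slope structure induced by [S].  When [phi] is an isometry,
   [parallel] is a bijection between the tangent vectors at [y] and [phi y]. *)
Definition induced (S : slope_structure r H) (SS : slope_data) :=
  [/\ forall y (h : tangent y) (nu : tangent (phi y)), parallel h nu ->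
        forall i, mslopes SS nu i = slopes S (val h) i,
      forall (v : vertex H) (a : {ffun tangent (phi (inl v)) -> 'I_r.+1})
             (b : {ffun star v -> 'I_r.+1}),
        (forall (h : star v) (nu : tangent (phi (inl v))),
           parallel (y := inl v) h nu -> a nu = b h) ->
        mrank SS a = rank S b
    & forall p (a : {ffun tangent (phi (inr p)) -> 'I_r.+1}),
        mrank SS a = standard_rank a].

End Induced.

Definition is_slope_structure (SS : slope_data) :=
  exists (H : graph) (lH : edge H -> R)
         (phi : realization lH -> realization l) (S : slope_structure r H),
    is_model phi /\ induced phi S SS.

(* [d_x f = s_a] *)
Definition slope_vector (SS : slope_data) (f : realization l -> R)
    (x : realization l) (a : {ffun tangent x -> 'I_r.+1}) :=
  forall nu : tangent x, slope f nu = mslopes SS nu (a nu).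

(* Membership of the slope vector in [S^x] entails [slope f nu \in S^nu]. *)
Definition compatible (SS : slope_data) (f : realization l -> R) :=
  forall x, exists a, jump (mrank SS (x := x)) a /\ slope_vector SS f a.

Definition RatDS (D : divisor l) (SS : slope_data) : set (realization l -> R) :=
  [set f | RatD D f /\ compatible SS f]%classic.

(** * Admissible semimodules *)

Definition semimodule (M : set (realization l -> R)) :=
  [/\ (M `<=` RatFun (l := l))%classic,
      forall f g, M f -> M g -> M (fun x => Num.min (f x) (g x))
    & forall f c, M f -> M (fun x => f x + c)].

Definition sup_closed (M : set (realization l -> R)) :=
  forall f, RatFun f ->
    (forall eps : R, 0 < eps ->
       exists2 g, M g & forall x, `|f x - g x| <= eps) ->
    M f.

Definition admissible (D : divisor l) (SS : slope_data)
    (M : set (realization l -> R)) :=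
  [/\ semimodule M, (M `<=` RatD D)%classic, sup_closed M,
      is_slope_structure SS /\ (M `<=` RatDS D SS)%classic
    & forall E : divisor l, effective E -> degree E = r%:Z ->
        exists2 f, M f &
          (forall x, exists2 a, slope_vector SS f a & E x <= mrank SS (x := x) a) /\
          (forall x, 0 <= D x + ord_at f x - E x)].

End MetricSlopeStructure.

(** * Placing the vertices of a subdivision *)

Section Placement.
Variables (R : realType) (G : graph) (l : edge G -> R) (n : edge G -> nat).

(* The new vertex [Tagged e j] is placed on [e] at distance [t e j.+1] from
   [src e]. *)
Definition placement (t : edge G -> nat -> R) :=
  forall e, knots 0 (l e) (n e).+1 (t e).

Definition placed_length (t : edge G -> nat -> R)
    (f : edge (subdivision n)) : R :=
  t (tag f) (tagged f).+1 - t (tag f) (tagged f).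

Definition placed_map (t : edge G -> nat -> R)
    (y : realization (placed_length t)) : realization l :=
  match y with
  | inl (inl v) => inl v
  | inl (inr w) => pt l (tag w) (t (tag w) (tagged w).+1)
  | inr p => let: (f, s) := val p in
             pt l (tag f) (t (tag f) (tagged f) + s)
  end.

End Placement.

Arguments placed_map {R G} l n t y.

(* Main.v *)
(** Functions of [Rat(D)] are concave along the edges of [G], because [D] is
    supported on the vertices.  Summing [D + div f >= 0] over the vertices in a
    sublevel set of [f] shows that their slopes are at most the sum of the
    [|D(v)|]; as [s_0] and [s_r] are slopes of the function attached to
    [E = r x], all the sets [S^nu] are bounded.

    Let [x] be inside an edge, let [s'_0 < ... < s'_r] be the slopes arriving at
    [x] from the left and [s_0 < ... < s_r] those leaving it to the right.  The
    function attached to [E = i (x + eps) + (r - i) (x - eps)] leaves [x] with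
    slope at least [s_i] and arrives with slope at most [s'_i], whence
    [s_i <= s'_i].  If equality holds for all [i], these functions show that every
    [(i, r - i)] is a jump of [rho_x], which makes [rho_x] standard.  So at each
    point where the slope structure is not locally constant with standard rank,
    the integer [s_0 + ... + s_r] drops, and this happens boundedly often on an
    edge.

    Padding with regular points, we may use the same number of subdivision
    vertices on every edge for all [M]: one subdivision of [G] and the finitely
    many slope structures on it with bounded slopes.

    The slope structure of [M] is a priori defined on an arbitrary model; it is
    carried over to [Gamma] because an isometry maps germs of segments to germs
    of segments, which is seen by testing the path metric against 1-Lipschitz
    functions supported near a point. *)

Require Import Defs.
From HB Require Import structures.
From mathcomp Require Import all_boot all_order all_algebra finmap.
From mathcomp Require Import boolp classical_sets reals.
From mathcomp Require Import ring lra zify.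

Set Implicit Arguments.
Unset Strict Implicit.
Unset Printing Implicit Defensive.

Import Order.TTheory GRing.Theory Num.Theory.
Local Open Scope ring_scope.

(** * Coordinates on edges and directions at a point *)

Definition shift (R : realType) (b : bool) (u s : R) := if b then u + s else u - s.

Section Coordinates.
Variables (R : realType) (G : graph) (l : edge G -> R).
Hypothesis l_gt0 : forall e, 0 < l e.
Local Notation Gamma := (realization l).

Lemma pt_interior e u (hu : (0 < u) && (u < l e)) :
  pt l e u =
  inr (exist (fun p : edge G * R => (0 < p.2) && (p.2 < l p.1)) (e, u) hu).
Proof.
rewrite /pt.
by rewrite (insubT (fun p : edge G * R => (0 < p.2) && (p.2 < l p.1)) (x := (e, u)) hu).
Qed.

Lemma pt_src e : pt l e 0 = inl (src e).
Proof. by rewrite /pt insubF /= ?ltxx ?lexx. Qed.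

Lemma pt_tgt e : pt l e (l e) = inl (tgt e).
Proof. by rewrite /pt insubF /= ?ltxx ?andbF // leNgt l_gt0. Qed.

Lemma inr_pt p : inr p = pt l (val p).1 (val p).2 :> Gamma.
Proof.
case: p => -[e u] hu /=; rewrite (pt_interior hu); congr inr; exact: val_inj.
Qed.

Lemma pt_cases e u : 0 <= u <= l e ->
  [\/ u = 0, u = l e | (0 < u) && (u < l e)].
Proof.
case/andP; rewrite !le_eqVlt => /orP[/eqP <-|u0]; first by constructor 1.
by case/orP=> [/eqP->|ul]; [constructor 2|constructor 3; rewrite u0].
Qed.

Lemma pt_inj e u e' u' : 0 < u < l e -> 0 <= u' <= l e' ->
  pt l e u = pt l e' u' -> e = e' /\ u = u'.
Proof.
move=> hu /pt_cases[->|->|hu']; rewrite ?pt_src ?pt_tgt (pt_interior hu) //.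
by rewrite (pt_interior hu') => -[-> ->].
Qed.

(* The coordinate of [x] on the edge [k.1]; when [x] is the vertex of a loop it
   depends on the orientation of [k]. *)
Definition base (x : Gamma) (k : oedge G) : R :=
  if k.2 then offset x k else l k.1 - offset x k.

(* [travel] for a direction that is not required to leave [x]. *)
Definition go (x : Gamma) (k : oedge G) (s : R) : Gamma :=
  along l k (offset x k + s).

Lemma goE x k s : go x k s = pt l k.1 (shift k.2 (base x k) s).
Proof. by rewrite /go /along /shift /base; case: k.2 => //; rewrite opprD addrA. Qed.

(** The interval is open at the end towards which the orientation [b] runs. For a loop both ends of
    [e] are the same point, and this is what tells the two coordinates apart. *)
Definition valid e (u : R) (b : bool) :=
  if b then (0 <= u < l e) else (0 < u <= l e).

Lemma valid_le e u b : valid e u b -> 0 <= u <= l e.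
Proof.
by rewrite /valid; case: b => /andP[h1 h2]; rewrite ?(ltW h1) ?(ltW h2) ?h1 ?h2.
Qed.

Lemma base_pt e u b : valid e u b ->
  outgoing (pt l e u) (e, b) /\ base (pt l e u) (e, b) = u.
Proof.
move=> hv; have := hv; have [->|->|hu] := pt_cases (valid_le hv); clear hv.
- by rewrite pt_src /valid; case: b; rewrite ?ltxx // /osrc /base /= eqxx.
- rewrite pt_tgt /valid; case: b; rewrite ?ltxx ?andbF // /osrc /base /= eqxx.
  by rewrite subr0.
- by rewrite (pt_interior hu) /base /=; case: b => _; rewrite eqxx ?subKr.
Qed.

Lemma outgoing_base x k : outgoing x k ->
  valid k.1 (base x k) k.2 /\ x = pt l k.1 (base x k).
Proof.
case: k => e b; case: x => [v|p] /=; rewrite /base /valid /osrc /=.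
  case: b => /= /eqP <-; rewrite ?lexx ?l_gt0 ?subr0 ?l_gt0 ?lexx.
    by rewrite pt_src.
  by rewrite pt_tgt.
move=> /eqP he; rewrite inr_pt {1 2}he.
case: p he => -[e' u] /= /andP[h1 h2] he; subst e'.
by case: b; rewrite ?subKr ?(ltW h1) ?(ltW h2) ?h1 ?h2.
Qed.

Lemma go_pt e u b s : valid e u b -> go (pt l e u) (e, b) s = pt l e (shift b u s).
Proof. by move=> hv; rewrite goE (base_pt hv).2. Qed.

Lemma go0 x k : outgoing x k -> go x k 0 = x.
Proof.
case/outgoing_base => _ {2}->; rewrite goE /shift.
by case: k.2; rewrite ?addr0 ?subr0.
Qed.

(** The factor 4 lets two tents of radius [eps], centred at distance [eps] from the two ends of one
    edge, have disjoint interiors; this occurs when [x] carries a loop. *)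
Lemma room (x : Gamma) : exists2 eps : R, 0 < eps &
  (forall e, 4 * eps <= l e) /\
  (if x is inr p then 4 * eps <= (val p).2 /\ 4 * eps <= l (val p).1 - (val p).2 else True).
Proof.
have [d d0 hd] : exists2 d : R, 0 < d & forall e, d <= l e.
  exists (\big[Num.min/1]_e l e).
    by elim/big_ind: _ => // a b a0 b0; rewrite lt_min a0.
  by move=> e; rewrite (bigD1 e) //= ge_min lexx.
case: x => [v|p].
  by exists (d / 4); [lra|split=> // e; have := hd e; lra].
have /andP[h1 h2] := valP p.
exists (Num.min d (Num.min (val p).2 (l (val p).1 - (val p).2)) / 4).
  have : 0 < Num.min d (Num.min (val p).2 (l (val p).1 - (val p).2)).
    by rewrite !lt_min d0 h1 subr_gt0.
  lra.
set m := Num.min _ _.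
have : m <= d /\ (m <= (val p).2 /\ m <= l (val p).1 - (val p).2).
  by rewrite /m !ge_min !lexx !orbT.
move=> [m1 [m2 m3]]; split; last by split; lra.
by move=> e; have := hd e; lra.
Qed.

End Coordinates.

(** * Walks and the path metric *)

Section Walks.
Variables (R : realType) (G : graph) (l : edge G -> R).
Local Notation Gamma := (realization l).

Lemma walk_ge0 (x y : Gamma) L : walk x y L -> 0 <= L.
Proof. by elim=> // *; rewrite addr_ge0. Qed.

Lemma walk_cat (x y z : Gamma) L L' : walk x y L -> walk y z L' -> walk x z (L + L').
Proof.
move=> w; elim: w L' => {x y L} [x L'|x y e a b L ha hb hx _ IH L' w].
  by rewrite add0r.
by rewrite -addrA; apply: walk_cons ha hb hx (IH _ w).
Qed.

Lemma walk_step e a b : 0 <= a <= l e -> 0 <= b <= l e ->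
  walk (pt l e a) (pt l e b) `|a - b|.
Proof. by move=> ha hb; rewrite -[X in walk _ _ X]addr0; apply: walk_cons (walk_nil _). Qed.

Lemma walk_sym (x y : Gamma) L : walk x y L -> walk y x L.
Proof.
elim=> {x y L} [x|x y e a b L ha hb -> _ w]; first exact: walk_nil.
by rewrite addrC; apply: walk_cat w _; rewrite distrC; apply: walk_step.
Qed.

Hypothesis hl : metric_graph l.

(** Makes the infimum in [dist] range over a nonempty set. Every point reaches a vertex along its
    edge, and vertices are joined by connectedness. *)
Lemma walk_ex (x y : Gamma) : exists L, walk x y L.
Proof.
case: hl => conn _ l0.
have toV (z : Gamma) : exists v L, walk z (inl v) L.
  case: z => [v|p]; first by exists v, 0; apply: walk_nil.
  exists (src (val p).1); exists `|(val p).2 - 0|.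
  have -> : inl (src (val p).1) = pt l (val p).1 0 by rewrite pt_src.
  rewrite inr_pt; have /andP[h1 h2] := valP p.
  by apply: walk_step; rewrite ?(ltW h1) ?(ltW h2) ?lexx ?(ltW (l0 _)).
have [u [L1 w1]] := toV x; have [v [L2 w2]] := toV y.
have [L3 w3] : exists L, walk (inl u : Gamma) (inl v) L.
  case/connectP: (conn u v) => s; elim: s u {w1} => [|a s IH] u /=.
    by move=> _ ->; exists 0; apply: walk_nil.
  case/andP=> /existsP[[e b] /andP[/eqP hs /eqP ht]] hp hv.
  have [L w] := IH _ hp hv; exists (l e + L); apply: walk_cat w.
  rewrite -hs -ht /osrc /otgt /=.
  have le0 := ltW (l0 e).
  case: b {hs ht}; rewrite /= -(pt_src l) -(pt_tgt l0).
    by have := @walk_step e 0 (l e); rewrite sub0r normrN ger0_norm ?lexx // le0; apply.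
  by have := @walk_step e (l e) 0; rewrite subr0 ger0_norm ?lexx // le0; apply.
by exists (L1 + (L3 + L2)); apply: walk_cat w1 (walk_cat w3 (walk_sym w2)).
Qed.

Lemma dist_le_walk (x y : Gamma) L : walk x y L -> dist x y <= L.
Proof.
by move=> w; apply: ge_inf => //; exists 0 => a; apply: walk_ge0.
Qed.

(** The increments of [F] telescope along a walk, so [F x - F y] is below every length. Lower bounds
    on distances are obtained from this test. *)
Lemma le_dist_lipschitz (F : Gamma -> R) (x y : Gamma) :
  (forall e a b, 0 <= a <= l e -> 0 <= b <= l e ->
     F (pt l e a) - F (pt l e b) <= `|a - b|) ->
  F x - F y <= dist x y.
Proof.
move=> hF; apply: lb_le_inf.
  by have [L w] := walk_ex x y; exists L.
move=> L; rewrite /=; elim=> {x y L} [x|x y e a b L ha hb -> _ IH].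
  by rewrite subrr.
by have := hF _ _ _ ha hb; lra.
Qed.

End Walks.

(** * Test functions and the branches at a point *)

Section Bumps.
Variables (R : realType) (eps : R).
Hypothesis eps_gt0 : 0 < eps.

Definition bump (c w : R) := Num.max 0 (eps - `|w - c|).

Lemma bump_far c w : eps <= `|w - c| -> bump c w = 0.
Proof. by move=> h; apply/max_idPl; rewrite subr_le0. Qed.

Lemma bump_lipschitz c a b : bump c a - bump c b <= `|a - b|.
Proof.
have h : `|b - c| <= `|b - a| + `|a - c| by exact: ler_distD.
rewrite distrC in h; move: h; rewrite (distrC b a) (distrC c b) /bump => h.
have := normr_ge0 (a - b).
by case: (lerP 0 (eps - `|a - c|)); case: (lerP 0 (eps - `|b - c|)); lra.
Qed.

(** The two tents have disjoint interiors, so their difference still has slopes in {-1, 0, 1}. In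
    each case of signs the triangle inequality among [a], [b], [c], [c'] makes the claim linear. *)
Lemma two_bumps_lipschitz c c' a b : 2 * eps <= `|c - c'| ->
  (bump c a - bump c' a) - (bump c b - bump c' b) <= `|a - b|.
Proof.
move=> hc; rewrite /bump.
have h1 := ler_distD b a c; have h2 := ler_distD a b c.
have h3 := ler_distD b a c'; have h4 := ler_distD a b c'.
have h5 := ler_distD a c c'; have h6 := ler_distD b c c'.
rewrite (distrC b a) in h2 h4; rewrite (distrC c a) in h5.
rewrite (distrC c b) in h6.
by case: (lerP 0 (eps - `|a - c|)); case: (lerP 0 (eps - `|b - c|));
   case: (lerP 0 (eps - `|a - c'|)); case: (lerP 0 (eps - `|b - c'|)); lra.
Qed.

End Bumps.

Lemma min_lipschitz (R : realType) (t u v u' v' : R) :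
  u - u' <= t -> v - v' <= t -> Num.min u v - Num.min u' v' <= t.
Proof. by case: (lerP u v); case: (lerP u' v'); lra. Qed.

Section LocalGeometry.
Variables (R : realType) (G : graph) (l : edge G -> R).
Hypothesis hl : metric_graph l.
Local Notation Gamma := (realization l).

Let l_gt0 : forall e, 0 < l e.
Proof. by case: hl. Qed.

Lemma base_inl (v : vertex G) k : base (inl v : Gamma) k = if k.2 then 0 else l k.1.
Proof. by rewrite /base /=; case: k.2; rewrite ?subr0. Qed.

Lemma base_inr (p : {p : edge G * R | (0 < p.2) && (p.2 < l p.1)}) k :
  k.1 = (val p).1 -> base (inr p : Gamma) k = (val p).2.
Proof. by rewrite /base /= => ->; case: k.2; rewrite ?subKr. Qed.

(* Up to distance [2 * eps] the directions at [x] run inside their edges, without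
   meeting each other. *)
Definition roomy (x : Gamma) eps :=
  [/\ 0 < eps, forall e, 4 * eps <= l e &
  if x is inr p then
    4 * eps <= (val p).2 /\ 4 * eps <= l (val p).1 - (val p).2 else True].

Lemma roomy_ex x : exists eps, roomy x eps.
Proof. by have [eps e0 [h1 h2]] := room l_gt0 x; exists eps. Qed.

Lemma roomy_le x eps eps' : roomy x eps -> 0 < eps' <= eps -> roomy x eps'.
Proof.
case=> e0 h1 h2 /andP[e'0 hle]; split=> // [e|].
  by have := h1 e; lra.
by case: x h2 => // p [h3 h4]; split; lra.
Qed.

Lemma roomy_valid x eps k s : roomy x eps -> outgoing x k -> 0 < s <= 2 * eps ->
  0 < shift k.2 (base x k) s < l k.1.
Proof.
case=> e0 he; case: x => [v _ _|p [h1 h2] /eqP hk].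
  rewrite base_inl /shift => /andP[s0 s1]; have := he k.1.
  by case: k.2 => ?; apply/andP; split; lra.
rewrite (base_inr hk) /shift hk => /andP[s0 s1].
by case: k.2; apply/andP; split; lra.
Qed.

Lemma roomy_shift_le x eps k s : roomy x eps -> outgoing x k -> 0 <= s <= 2 * eps ->
  0 <= shift k.2 (base x k) s <= l k.1.
Proof.
move=> hr hk /andP[]; rewrite le_eqVlt => /orP[/eqP <- _|s0 s1].
  have [/valid_le + _] := outgoing_base l_gt0 hk.
  by rewrite /shift; case: k.2; rewrite ?addr0 ?subr0.
by have /andP[h1 h2] := roomy_valid hr hk (introT andP (conj s0 s1)); rewrite !ltW.
Qed.

Lemma dist_go_le x eps k s s' : roomy x eps -> outgoing x k ->
  0 <= s <= eps -> 0 <= s' <= eps -> dist (go x k s) (go x k s') <= `|s - s'|.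
Proof.
move=> hr hk hs hs'; have [e0 _ _] := hr; rewrite !goE.
have -> : `|s - s'| = `|shift k.2 (base x k) s - shift k.2 (base x k) s'|.
  rewrite /shift; case: k.2; first by congr `|_|; lra.
  by rewrite -[RHS]normrN; congr `|_|; lra.
apply/dist_le_walk/walk_step; apply: (roomy_shift_le hr hk);
  [move: hs|move: hs'] => /andP[-> /=]; lra.
Qed.

(** Two directions on one edge are either the two ends of a loop, with centres [l - 2 eps] apart, or
    the two sides of an interior point, with centres [2 eps] apart. *)
Lemma centers_apart x eps k k' : roomy x eps -> outgoing x k -> outgoing x k' ->
  k != k' -> k.1 = k'.1 ->
  2 * eps <= `|shift k.2 (base x k) eps - shift k'.2 (base x k') eps|.
Proof.
case: k k' => [e b] [e' b'] [e0 he hx] hk hk' + /= hee; subst e'.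
rewrite xpair_eqE eqxx /= => hb.
have -> : b' = ~~ b by case: b b' hb {hk hk'} => -[].
rewrite ler_normr; case: x hx hk {hk'} => [v _ _|p [h1 h2] /eqP hk].
  rewrite !base_inl /shift /=; have := he e.
  by case: b {hb} => /= h; apply/orP; [right|left]; lra.
rewrite !base_inr // /shift.
by case: b {hb hk} => /=; apply/orP; [left|right]; lra.
Qed.

(** Ensures that the tent of radius [eps] around the centre vanishes at both ends of the edge. *)
Lemma center_range x eps k : roomy x eps -> outgoing x k ->
  eps <= shift k.2 (base x k) eps <= l k.1 - eps.
Proof.
case=> e0 he; case: x => [v _ _|p [h1 h2] /eqP hk].
  rewrite base_inl /shift; have := he k.1.
  by case: k.2 => ?; apply/andP; split; lra.
rewrite (base_inr hk) /shift hk.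
by case: k.2; apply/andP; split; lra.
Qed.

(* The test function rises to [eps] along [k], falls to [-eps] along [k']. *)
Lemma dist_go_ge x eps k k' s s' : roomy x eps -> outgoing x k -> outgoing x k' ->
  k != k' -> 0 <= s <= eps -> 0 <= s' <= eps ->
  s + s' <= dist (go x k s) (go x k' s').
Proof.
move=> hr hk hk' hkk /andP[s0 s1] /andP[s0' s1']; have [e0 he _] := hr.
pose c k := shift k.2 (base x k) eps.
pose B (k : oedge G) e w := if e == k.1 then bump eps (c k) w else 0.
pose F (z : Gamma) :=
  if z is inr q then B k (val q).1 (val q).2 - B k' (val q).1 (val q).2 else 0.
have B_end j e w : outgoing x j -> w = 0 \/ w = l e -> B j e w = 0.
  rewrite /B => hj hw; case: eqP => // ->{} in hw *.
  apply: bump_far; have /andP[h1 h2] := center_range hr hj.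
  by rewrite ler_normr; apply/orP; case: hw => ->; [right|left]; rewrite /c; lra.
have Fpt e w : 0 <= w <= l e -> F (pt l e w) = B k e w - B k' e w.
  move=> /pt_cases[->|->|hw].
  - by rewrite pt_src /= !B_end ?subrr //; left.
  - by rewrite (pt_tgt l_gt0) /= !B_end ?subrr //; right.
  - by rewrite (pt_interior hw).
have Flip e a b : 0 <= a <= l e -> 0 <= b <= l e ->
    F (pt l e a) - F (pt l e b) <= `|a - b|.
  move=> ha hb; rewrite !Fpt // /B.
  case: eqP => [ek|_]; case: eqP => [ek'|_].
  - apply: two_bumps_lipschitz => //; apply: centers_apart => //.
    by rewrite -ek.
  - by rewrite !subr0; apply: bump_lipschitz.
  - rewrite !sub0r opprK addrC distrC; exact: bump_lipschitz.
  - by rewrite !subr0.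
(* At distance [t] along [j] the centre of the tent of [j] is [eps - t] away, so this tent has value
   [t]; the centre of the other tent is at least [eps + t] away, so that one vanishes. *)
have Fgo j j' t : outgoing x j -> outgoing x j' -> j != j' -> 0 <= t <= eps ->
    B j j.1 (shift j.2 (base x j) t) - B j' j.1 (shift j.2 (base x j) t) = t.
  move=> hj hj' hjj /andP[t0 t1]; rewrite /B eqxx.
  have d1 : `|shift j.2 (base x j) t - c j| = eps - t.
    rewrite /c /shift; case: j.2.
      by rewrite ler0_norm; lra.
    by rewrite ger0_norm; lra.
  rewrite /bump {1}d1 max_r; last by lra.
  case: eqP => [ejj|]; last by lra.
  rewrite max_l; first by lra.
  have := centers_apart hr hj hj' hjj ejj; rewrite -/(c j) -/(c j').
  have := ler_distD (shift j.2 (base x j) t) (c j) (c j').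
  rewrite distrC in d1; rewrite d1; lra.
have hF := le_dist_lipschitz hl (go x k s) (go x k' s') Flip.
have r1 : 0 <= shift k.2 (base x k) s <= l k.1.
  by apply: roomy_shift_le hr hk _; rewrite s0; lra.
have r2 : 0 <= shift k'.2 (base x k') s' <= l k'.1.
  by apply: roomy_shift_le hr hk' _; rewrite s0'; lra.
move: hF; rewrite !goE !Fpt // Fgo ?s0 //.
have := Fgo k' k s' hk' hk; rewrite eq_sym s0' s1' => /(_ hkk isT); lra.
Qed.

End LocalGeometry.

(** * Small balls are stars *)

Section DistanceFromPoint.
Variables (R : realType) (G : graph) (l : edge G -> R).
Hypothesis hl : metric_graph l.
Local Notation Gamma := (realization l).

Let l_gt0 : forall e, 0 < l e.
Proof. by case: hl. Qed.

(** At a vertex [k] itself serves. Inside an edge the side of [x] on which [w] lies decides the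
    orientation, so [k'] may be the reverse of [k]. *)
Lemma near_go x eps k w : roomy x eps -> outgoing x k -> 0 <= w <= l k.1 ->
  `|w - base x k| < eps ->
  exists2 k', outgoing x k' & pt l k.1 w = go x k' `|w - base x k|.
Proof.
move=> hr hk /andP[w0 w1] _; case: x hr hk => [v|p] _ hk.
  exists k => //; rewrite goE base_inl; case: k.2; rewrite /shift.
    by rewrite subr0 add0r ger0_norm.
  by rewrite ler0_norm ?subr_le0 //; congr pt; lra.
move/eqP: (hk) => hp; exists (k.1, (val p).2 <= w); first exact: hk.
rewrite goE !base_inr //= /shift; case: leP => h.
  by rewrite ger0_norm ?subr_ge0 //; congr pt; lra.
by rewrite ltr0_norm ?subr_lt0 //; congr pt; lra.
Qed.

Section StarDistance.
Variables (x : Gamma) (eps : R).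
Hypothesis hr : roomy x eps.

(** [F] is the distance to [x] cut off at [eps]. An edge sees [x] through each of its orientations
    that leave [x], whence a minimum of two terms; for a loop at [x] they measure from its two
    ends. *)
Let d k w : R := if outgoing x k then `|w - base x k| else eps.
Let F0 e w : R := Num.min eps (Num.min (d (e, true) w) (d (e, false) w)).
Let F (z : Gamma) : R :=
  match z with
  | inl v => if x == inl v then 0 else eps
  | inr q => F0 (val q).1 (val q).2
  end.

Let eps_gt0 : 0 < eps. Proof. by case: hr. Qed.

Let d_ge0 k w : 0 <= d k w.
Proof. by rewrite /d; case: ifP => // _; apply: ltW. Qed.

Let F0_eq0 k : outgoing x k -> F0 k.1 (base x k) = 0.
Proof.
move=> hk; have hd : d k (base x k) = 0 by rewrite /d hk subrr normr0.
apply/eqP; rewrite eq_le; apply/andP; split; rewrite /F0.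
  by rewrite !ge_min; case: k hd {hk} => e [] -> ; rewrite lexx !orbT.
by rewrite !le_min !d_ge0 ltW.
Qed.

(** Consistency of the two clauses of [F]: a vertex closer than [eps] to [x] on some branch is [x]
    itself, because the other points of a short branch lie inside an edge. *)
Let F_end e b w v : (w = if b then 0 else l e) -> inl v = pt l e w ->
  (if x == inl v then 0 else eps) = F0 e w.
Proof.
move=> hw hv; have hw2 : valid l e w b.
  by rewrite /valid hw; case: b {hw}; rewrite ?lexx ?l_gt0.
case: eqP => [hx|hx].
  have := base_pt l_gt0 hw2; rewrite -hv -hx => -[hk hb].
  by rewrite -[in RHS]hb (F0_eq0 hk).
apply/esym/min_idPl; rewrite le_min.
suff H b' : eps <= d (e, b') w by rewrite !H.
rewrite /d; case: ifP => // hk; rewrite leNgt; apply/negP => hlt.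
have [k' hk' hgo] := near_go (k := (e, b')) hr hk (valid_le hw2) hlt.
move: hgo; rewrite /= -hv; have [->|h0] := eqVneq `|w - base x (e, b')| 0.
  by rewrite (go0 l_gt0 hk') => h; case: hx.
have hs : 0 < `|w - base x (e, b')| <= 2 * eps.
  by rewrite normr_gt0 -normr_eq0 h0 /=; have := eps_gt0; lra.
by rewrite goE (pt_interior (roomy_valid hr hk' hs)).
Qed.

Let F_pt e w : 0 <= w <= l e -> F (pt l e w) = F0 e w.
Proof.
case/pt_cases=> [->|->|hw]; last by rewrite (pt_interior hw).
  by rewrite pt_src /=; apply: (@F_end e true); rewrite ?pt_src.
by rewrite (pt_tgt l_gt0) /=; apply: (@F_end e false); rewrite ?(pt_tgt l_gt0).
Qed.

Let F_lipschitz e a b : 0 <= a <= l e -> 0 <= b <= l e ->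
  F (pt l e a) - F (pt l e b) <= `|a - b|.
Proof.
move=> ha hb; rewrite !F_pt // /F0.
have dl k : d k a - d k b <= `|a - b|.
  rewrite /d; case: ifP => _; last by rewrite subrr.
  have := ler_distD b a (base x k); lra.
apply: min_lipschitz; first by rewrite subrr.
by apply: min_lipschitz.
Qed.

Let F_x : F x = 0.
Proof.
case hx : (x) => [v|p]; first by rewrite /= hx eqxx.
have hk : outgoing x ((val p).1, true) by rewrite hx /=.
have := F0_eq0 hk; rewrite /= {1}hx base_inr //; exact.
Qed.

Let F_le_dist z : F z <= dist x z.
Proof.
have := le_dist_lipschitz (F := fun z => - F z) hl x z.
rewrite F_x oppr0 sub0r opprK; apply => e a b ha hb.
by rewrite opprK addrC distrC; apply: F_lipschitz.
Qed.

(** As [F] is 1-Lipschitz along edges, [F z] is at most [dist x z], hence below [eps]. So [z] has a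
    coordinate close to one of [x], and [near_go] names the branch. The parameter on it equals the
    distance, being bounded above by [F] and below by the length of the segment. *)
Lemma dist_lt_go z : dist x z < eps ->
  x = z \/ exists2 k, outgoing x k & z = go x k (dist x z).
Proof.
move=> hd; have := le_lt_trans (F_le_dist z) hd.
case: z hd => [v|p] hd /=.
  by case: eqP => [|_]; [left|rewrite ltxx].
have hp := valP p; have hp' : 0 <= (val p).2 <= l (val p).1.
  by case/andP: hp => /ltW -> /ltW ->.
rewrite /F0 !gt_min ltxx /= => h.
have [k [hk kp kd]] : exists k, [/\ outgoing x k, k.1 = (val p).1
    & F (inr p) = `|(val p).2 - base x k|].
  have [b hb hm] : exists2 b, d ((val p).1, b) (val p).2 < eps &
      Num.min (d ((val p).1, true) (val p).2) (d ((val p).1, false) (val p).2) =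
      d ((val p).1, b) (val p).2.
    by case: (lerP (d (_, true) _) (d (_, false) _)) h => h1 /orP[] h2;
      [exists true|exists true|exists false|exists false];
      rewrite //; [apply: le_lt_trans h1 h2|apply: lt_trans h1 h2].
  have hk : outgoing x ((val p).1, b).
    by apply: contraLR hb; rewrite /d => /negbTE ->; rewrite ltxx.
  exists ((val p).1, b); split=> //.
  by rewrite /= /F0 hm min_r ?ltW // /d hk.
have hF := F_le_dist (inr p); rewrite kd in hF.
have hlt := le_lt_trans hF hd.
rewrite -kp in hp'; have [k' hk' hgo] := near_go hr hk hp' hlt.
right; exists k' => //; rewrite {1}inr_pt -kp hgo; congr go.
apply/eqP; rewrite eq_le hF /= inr_pt -kp hgo -{1}(go0 l_gt0 hk').
have := dist_go_le (s := 0) (s' := `|(val p).2 - base x k|) hl hr hk'.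
by rewrite sub0r normrN normr_id !normr_ge0 lexx (ltW hlt) (ltW eps_gt0); apply.
Qed.

(** The segment itself gives the upper bound and [F] the lower one. On a loop [F] also measures from
    the other end, which is further away since [4 * eps <= l]. *)
Lemma dist_go k s : outgoing x k -> 0 <= s < eps -> dist x (go x k s) = s.
Proof.
move=> hk /andP[s0 s1]; apply/eqP; rewrite eq_le; apply/andP; split.
  rewrite -{1}(go0 l_gt0 hk).
  have := dist_go_le (s := 0) (s' := s) hl hr hk.
  by rewrite sub0r normrN ger0_norm // lexx (ltW s1) (ltW eps_gt0) s0; apply.
apply: le_trans (F_le_dist _).
have hin : 0 <= shift k.2 (base x k) s <= l k.1.
  by apply: (roomy_shift_le hl hr hk); rewrite s0 /=; lra.
rewrite goE F_pt // /F0 !le_min (ltW s1) /=.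
suff H b : s <= d (k.1, b) (shift k.2 (base x k) s) by rewrite !H.
rewrite /d; case: ifP => hk2; last exact: ltW.
have ds : `|shift k.2 (base x k) s - base x k| = s.
  by rewrite /shift; case: k.2; [rewrite ger0_norm|rewrite ler0_norm]; lra.
case hx: (x) => [v|p]; last first.
  by move: hk ds; rewrite hx => /eqP /= hk; rewrite !base_inr // => ->.
have [_ he _] := hr; have := he k.1; move: ds.
rewrite hx !base_inl /= /shift; case: k.2; case: b {hk2} => /= e1 h; rewrite ?e1 //.
  by rewrite ler0_norm; lra.
by rewrite ger0_norm; lra.
Qed.

End StarDistance.
End DistanceFromPoint.

(** * Germs of segments under isometries *)

Section Germs.
Variables (R : realType) (G : graph) (l : edge G -> R).
Hypothesis hl : metric_graph l.

Let l_gt0 : forall e, 0 < l e.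
Proof. by case: hl. Qed.

Lemma dist_refl_le (z : realization l) : dist z z <= 0.
Proof. exact/dist_le_walk/walk_nil. Qed.

Lemma common_roomy (x : realization l) (eps : R) : 0 < eps ->
  exists2 s, 0 < s < eps & roomy x s.
Proof.
move=> e0; have [e1 hr] := roomy_ex hl x; have [e10 _ _] := hr.
exists (Num.min e1 eps / 2).
  have : 0 < Num.min e1 eps by rewrite lt_min e10.
  have : Num.min e1 eps <= eps by rewrite ge_min lexx orbT.
  by move=> h1 h2; apply/andP; split; lra.
have : 0 < Num.min e1 eps by rewrite lt_min e10.
have : Num.min e1 eps <= e1 by rewrite ge_min lexx.
by move=> h1 h2; apply: roomy_le hr _; apply/andP; split; lra.
Qed.

(** Points at distance [s] along two different directions are at least [2 s] apart, whereas equal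
    points have distance at most 0. *)
Lemma go_inj (x : realization l) k k' eps : outgoing x k -> outgoing x k' ->
  0 < eps -> (forall s, 0 <= s < eps -> go x k s = go x k' s) -> k = k'.
Proof.
move=> hk hk' e0 he; have [s /andP[s0 s1] hr] := common_roomy x e0.
apply/eqP/negPn/negP => hkk.
have := dist_go_ge (s := s) (s' := s) hl hr hk hk' hkk.
rewrite lexx (ltW s0) he ?(ltW s0) // => /(_ isT isT).
have := dist_refl_le (go x k' s); lra.
Qed.

End Germs.

Section IsometryGerms.
Variables (R : realType) (G H : graph) (l : edge G -> R) (lH : edge H -> R).
Hypotheses (hl : metric_graph l) (hlH : metric_graph lH).
Variable phi : realization lH -> realization l.
Hypothesis phi_dist : forall x y, dist (phi x) (phi y) = dist x y.

Let l_gt0 : forall e, 0 < l e.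
Proof. by case: hl. Qed.

Let lH_gt0 : forall e, 0 < lH e.
Proof. by case: hlH. Qed.

(** [parallel] on bare oriented edges, which keeps the dependent types [tangent y] and
    [tangent (phi y)] out of the arguments. *)
Definition par y (h : oedge H) (k : oedge G) :=
  exists2 eps : R, 0 < eps &
    forall s, 0 <= s < eps -> phi (go y h s) = go (phi y) k s.

(** Each point of a short branch at [y] lands on some branch at [phi y], at the same distance. Two
    points landing on different branches would be [s + s'] apart, but they are at most [|s - s'|]
    apart, so the branch never changes. *)
Lemma par_ex y h : outgoing y h -> exists2 k, outgoing (phi y) k & par y h k.
Proof.
move=> hh; have [e1 hr1] := roomy_ex hlH y; have [e10 _ _] := hr1.
have [e2 /andP[e20 e21] hr2] := common_roomy hl (phi y) e10.
have germ s : 0 < s < e2 ->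
    exists2 k, outgoing (phi y) k & phi (go y h s) = go (phi y) k s.
  case/andP=> s0 s1; have ds : dist (phi y) (phi (go y h s)) = s.
    by rewrite phi_dist (dist_go hlH hr1) ?ltW //=; lra.
  have hlt : dist (phi y) (phi (go y h s)) < e2 by rewrite ds.
  case: (dist_lt_go hl hr2 hlt) => [heq|[k hk hgo]].
    by have := dist_refl_le (phi y); rewrite {2}heq ds; lra.
  by exists k => //; rewrite {1}hgo ds.
(* The branch is read off at the reference distance [e2 / 2], and every other point is compared with
   that one. *)
have hs0 : 0 < e2 / 2 < e2 by apply/andP; split; lra.
have [k0 hk0 hgo0] := germ _ hs0; exists k0 => //; exists e2 => // s /andP[].
rewrite le_eqVlt => /orP[/eqP<- _|s0 s1]; first by rewrite !go0.
have hs : 0 < s < e2 by rewrite s0.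
have [k hk hgo] := germ _ hs; rewrite hgo.
have [->//|hkk] := eqVneq k k0.
have := dist_go_ge (s := s) (s' := e2 / 2) hl hr2 hk hk0 hkk.
rewrite -hgo -hgo0 phi_dist (ltW s0) (ltW s1) => /(_ isT) hd.
have : s + e2 / 2 <= dist (go y h s) (go y h (e2 / 2)).
  by apply: hd; apply/andP; split; lra.
have : dist (go y h s) (go y h (e2 / 2)) <= `|s - e2 / 2|.
  by apply: (dist_go_le hlH hr1 hh); apply/andP; split; lra.
by move=> h1; case: (ger0P (s - e2 / 2)) h1 => _ h1 h2; exfalso; lra.
Qed.

Lemma par_unique y h k k' : outgoing (phi y) k -> outgoing (phi y) k' ->
  par y h k -> par y h k' -> k = k'.
Proof.
move=> hk hk' [e1 e10 h1] [e2 e20 h2].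
apply: (go_inj hl hk hk' (eps := Num.min e1 e2)); first by rewrite lt_min e10.
by move=> s; rewrite lt_min => /and3P[s0 s1 s2]; rewrite -h1 -?h2 ?s0.
Qed.

Lemma par_inj y h h' k : outgoing y h -> outgoing y h' ->
  par y h k -> par y h' k -> h = h'.
Proof.
move=> hh hh' [e1 e10 h1] [e2 e20 h2].
have e0 : 0 < Num.min e1 e2 by rewrite lt_min e10.
have [s /andP[s0]] := common_roomy hlH y e0; rewrite lt_min => /andP[s1 s2] hr.
apply/eqP/negPn/negP => hkk.
have := dist_go_ge (s := s) (s' := s) hlH hr hh hh' hkk.
rewrite lexx (ltW s0) -phi_dist h1 ?h2 ?(ltW s0) // => /(_ isT isT).
have := dist_refl_le (go (phi y) k s); lra.
Qed.

End IsometryGerms.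

Section ModelGerms.
Variables (R : realType) (G H : graph) (l : edge G -> R) (lH : edge H -> R).
Variable phi : realization lH -> realization l.
Hypotheses (hl : metric_graph l) (hphi : is_model phi).

(** The inverse of [phi] is an isometry too, and [par_ex] applies to it. *)
Lemma par_surj y k : outgoing (phi y) k -> exists2 h, outgoing y h & par phi y h k.
Proof.
case: hphi => hlH [psi phiK psiK] phi_dist hk.
have psi_dist x z : dist (psi x) (psi z) = dist x z by rewrite -phi_dist !psiK.
have [h + [e e0 he]] := par_ex hlH hl psi_dist hk.
rewrite phiK => hh; exists h => //; exists e => // s hs.
by rewrite -[RHS]psiK he // phiK.
Qed.

(** Choice gives maps in both directions; [par_inj] and [par_unique] make them mutually inverse.
    Rank functions are carried along this bijection. *)
Lemma tangent_bijection y : exists tau : tangent y -> tangent (phi y),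
  bijective tau /\ forall h nu, parallel h nu <-> nu = tau h.
Proof.
case: (hphi) => hlH _ phi_dist.
have htau (h : tangent y) : exists nu : tangent (phi y), par phi y (val h) (val nu).
  have [k hk hpar] := par_ex hl hlH phi_dist (valP h).
  by exists (exist _ k hk).
have hsig (nu : tangent (phi y)) : exists h : tangent y, par phi y (val h) (val nu).
  by have [h hh hpar] := par_surj (valP nu); exists (exist _ h hh).
have [tau tauP] := choice htau; have [sig sigP] := choice hsig.
exists tau; split=> [|h nu].
  exists sig => x; apply: val_inj.
    exact: (par_inj hlH phi_dist (valP _) (valP x) (sigP (tau x)) (tauP x)).
  exact: (par_unique hl (valP _) (valP x) (tauP (sig x)) (sigP x)).
split=> [hp|->]; last exact: tauP.
exact/val_inj/(par_unique hl (valP nu) (valP (tau h)) hp (tauP h)).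
Qed.

End ModelGerms.

(** * Rank functions on hypercubes *)

Section RankFunctionTheory.
Variable r : nat.

Lemma rank_function_ext (I : finType) (rho rho' : {ffun I -> 'I_r.+1} -> int) :
  rho =1 rho' -> rank_function rho' -> rank_function rho.
Proof. by move=> /funext ->. Qed.

(** Supermodularity reflects the convexity of [max (-1) (r - t)] in [t]: the coordinate sums of the
    join and of the meet add up to those of [a] and [b], and are spread further apart. *)
Lemma rank_function_standard (I : finType) :
  rank_function (@standard_rank r I).
Proof.
have mono (a b : {ffun I -> 'I_r.+1}) : cube_le a b ->
    \sum_i (a i)%:Z <= \sum_i (b i)%:Z.
  by move=> hab; apply: ler_sum => i _; rewrite lez_nat.
have S_ge0 (a : {ffun I -> 'I_r.+1}) : 0 <= \sum_i (a i)%:Z.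
  by apply: sumr_ge0 => i _; rewrite lez_nat.
split.
- move=> i t; rewrite /standard_rank (bigD1 i) //= big1 => [|j /negbTE hj].
    by rewrite ffunE eqxx addr0; have := ltn_ord t; lia.
  by rewrite ffunE hj.
- by move=> a b /mono; rewrite /standard_rank; lia.
- move=> a b; rewrite /standard_rank.
  have e : \sum_i (cube_max a b i)%:Z + \sum_i (cube_min a b i)%:Z
         = \sum_i (a i)%:Z + \sum_i (b i)%:Z.
    rewrite -!big_split /=; apply: eq_bigr => i _; rewrite !ffunE.
    by case: leqP => _ //; rewrite addrC.
  have h1 : \sum_i (cube_min a b i)%:Z <= \sum_i (a i)%:Z.
    by apply: mono => i; rewrite !ffunE; case: (leqP (a i) (b i)) => // /ltnW.
  have h2 : \sum_i (cube_min a b i)%:Z <= \sum_i (b i)%:Z.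
    by apply: mono => i; rewrite !ffunE; case: (leqP (a i) (b i)).
  lia.
- by move=> a; rewrite /standard_rank; have := S_ge0 a; lia.
Qed.

Lemma rank_function_reindex (I J : finType) (sigma : J -> I)
    (rho : {ffun J -> 'I_r.+1} -> int) : bijective sigma -> rank_function rho ->
  rank_function (fun b : {ffun I -> 'I_r.+1} => rho [ffun j => b (sigma j)]).
Proof.
case=> tau sK tK [h1 h2 h3 h4]; split=> [i t|a b hab|a b|a]; last exact: h4.
- rewrite -(h1 (tau i)); congr rho; apply/ffunP => j; rewrite !ffunE.
  by rewrite -{1}(tK i) (can_eq sK).
- by apply: h2 => j; rewrite !ffunE.
- have -> : [ffun j => cube_max a b (sigma j)]
      = cube_max [ffun j => a (sigma j)] [ffun j => b (sigma j)].
    by apply/ffunP => j; rewrite !ffunE.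
  have -> : [ffun j => cube_min a b (sigma j)]
      = cube_min [ffun j => a (sigma j)] [ffun j => b (sigma j)].
    by apply/ffunP => j; rewrite !ffunE.
  exact: h3.
Qed.

Section RankFunction.
Variables (I : finType) (rho : {ffun I -> 'I_r.+1} -> int).
Hypothesis hrho : rank_function rho.

(** [a] dominates the axis point [axis i (a i)]. A lower bound on the rank thus becomes an upper
    bound on every index. *)
Lemma rank_le_axis (a : {ffun I -> 'I_r.+1}) i : rho a <= r%:Z - (a i)%:Z.
Proof.
case: hrho => h1 h2 _ _; rewrite -(h1 i); apply: h2 => j.
by rewrite ffunE; case: eqP => [->|].
Qed.

(** Supermodularity for [a] and the axis point of height [a i + 1]: their join is [a + e_i] and
    their meet is the axis point of height [a i]. *)
Lemma rank_succ_ge (a : {ffun I -> 'I_r.+1}) i : (a i < r)%N -> rho a - 1 <= rho (cube_succ a i).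
Proof.
move=> hi; have [h1 _ h3 _] := hrho.
have ho : (a i).+1 = (inord (a i).+1 : 'I_r.+1) :> nat by rewrite inordK.
have := h3 a (axis i (inord (a i).+1)).
have -> : cube_max a (axis i (inord (a i).+1)) = cube_succ a i.
  apply/ffunP => j; rewrite !ffunE; case: eqP => [->|_]; first by rewrite -ho leqnSn.
  by case: leqP => // h; apply/val_inj/eqP; rewrite eqn_leq h leq0n.
have -> : cube_min a (axis i (inord (a i).+1)) = axis i (a i).
  apply/ffunP => j; rewrite !ffunE; case: eqP => [->|_]; first by rewrite -ho leqnSn.
  by case: leqP => // h; apply/val_inj/eqP; rewrite eqn_leq h leq0n.
rewrite !h1 -ho; lia.
Qed.

(* On the antidiagonal the jump conditions make the rank constant, hence zero. *)
Lemma rank_standard_of_jumps (i0 i1 : I) : i0 != i1 ->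
  (forall i, i = i0 \/ i = i1) ->
  (forall a : {ffun I -> 'I_r.+1}, (a i0 + a i1 = r)%N -> jump rho a) ->
  forall a, rho a = standard_rank a.
Proof.
move=> ne two hj; have [h1 h2 _ h4] := hrho.
pose C x y : {ffun I -> 'I_r.+1} := [ffun i => inord (if i == i0 then x else y)].
have C0 x y : (x <= r)%N -> C x y i0 = x :> nat.
  by move=> hx; rewrite ffunE eqxx inordK.
have C1 x y : (y <= r)%N -> C x y i1 = y :> nat.
  by move=> hy; rewrite ffunE eq_sym (negbTE ne) inordK.
have S0 x y : (x < r)%N -> (y <= r)%N -> cube_succ (C x y) i0 = C x.+1 y.
  move=> hx hy; apply/ffunP => j; apply: val_inj.
  by rewrite !ffunE eqxx; case: (two j) => ->; rewrite ?eqxx 1?eq_sym ?(negbTE ne) ?[inord x]inordK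
    ?[X in inord X.+1]inordK // ltnW.
have S1 x y : (x <= r)%N -> (y < r)%N -> cube_succ (C x y) i1 = C x y.+1.
  move=> hx hy; apply/ffunP => j; apply: val_inj.
  rewrite !ffunE; case: (two j) => ->.
    by rewrite (negbTE ne) eqxx.
  by rewrite eqxx eq_sym (negbTE ne) [X in inord X.+1]inordK // ltnW.
have d0 x y : (x < r)%N -> (y <= r)%N -> rho (C x y) - 1 <= rho (C x.+1 y).
  by move=> hx hy; rewrite -S0 //; apply: rank_succ_ge; rewrite C0 // ltnW.
have d1 x y : (x <= r)%N -> (y < r)%N -> rho (C x y) - 1 <= rho (C x y.+1).
  by move=> hx hy; rewrite -S1 //; apply: rank_succ_ge; rewrite C1 // ltnW.
have J x y : (x + y = r)%N -> [/\ 0 <= rho (C x y),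
    (x < r)%N -> rho (C x.+1 y) = rho (C x y) - 1 &
    (y < r)%N -> rho (C x y.+1) = rho (C x y) - 1].
  move=> hxy; have [hx hy] : (x <= r)%N /\ (y <= r)%N by lia.
  have [|j1 j2] := hj (C x y); first by rewrite C0 // C1.
  split=> // hlt; first by rewrite -S0 // j2 // C0.
  by rewrite -S1 // j2 // C1.
have axis0 x : (x <= r)%N -> rho (C x 0%N) = r%:Z - x%:Z.
  move=> hx; have := h1 i0 (inord x); rewrite inordK // => <-; congr rho.
  apply/ffunP => j; rewrite !ffunE; case: eqP => // _; apply: val_inj => /=.
  by rewrite inordK.
have axis1 y : (y <= r)%N -> rho (C 0%N y) = r%:Z - y%:Z.
  move=> hy; have := h1 i1 (inord y); rewrite inordK // => <-; congr rho.
  apply/ffunP => j; rewrite !ffunE; case: (two j) => ->; apply: val_inj.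
    by rewrite eqxx (negbTE ne) /= inordK.
  by rewrite eqxx eq_sym (negbTE ne).
(* [(x, r - x)] and [(x + 1, r - x - 1)] both lie one step below [(x + 1, r - x)]. Both are jumps,
   so they have equal rank; the induction starts at the axis point [(0, r)]. *)
have diag x : (x <= r)%N -> rho (C x (r - x)%N) = 0.
  elim: x => [|x IH] hx; first by rewrite subn0 axis1 // subrr.
  have [_ j0 _] := J x (r - x)%N ltac:(lia).
  have [_ _ j1] := J x.+1 (r - x.+1)%N ltac:(lia).
  have := j1 ltac:(lia); rewrite -subSn // subSS j0 // IH ?(ltnW hx) //; lia.
(* The rank falls by at most one per step away from the axis. *)
have lower x y : (x <= r)%N -> (y <= r)%N -> r%:Z - x%:Z - y%:Z <= rho (C x y).
  move=> hx; elim: y => [|y IH] hy; first by rewrite axis0 // subr0.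
  by have := d1 x y hx hy; have := IH (ltnW hy); lia.
(* The same bound, followed from the antidiagonal down to [(x, y)], which is [d] steps below it. *)
have upper d x y : (x + y + d = r)%N -> rho (C x y) <= d%:Z.
  elim: d y => [|d IH] y hd.
    by have -> : y = (r - x)%N by [lia]; rewrite diag //; lia.
  have := IH y.+1 ltac:(lia); have := d1 x y ltac:(lia) ltac:(lia); lia.
move=> a; have -> : a = C (a i0) (a i1).
  apply/ffunP => j; rewrite ffunE; case: (two j) => ->.
    by rewrite eqxx inord_val.
  by rewrite eq_sym (negbTE ne) inord_val.
have hx : (a i0 <= r)%N by rewrite -ltnS.
have hy : (a i1 <= r)%N by rewrite -ltnS.
move: (a i0 : nat) (a i1 : nat) hx hy => x y hx hy.
have -> : standard_rank (C x y) = Num.max (-1) (r%:Z - (x%:Z + y%:Z)).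
  rewrite /standard_rank (bigD1 i0) // (bigD1 i1) 1?eq_sym //= big1 => [|j].
    by rewrite C0 // C1 // addr0.
  by case: (two j) => ->; rewrite eqxx ?andbF.
have [hle|hlt] := leqP (x + y) r.
  have := lower x y hx hy; have := upper (r - (x + y))%N x y ltac:(lia); lia.
(* Beyond the antidiagonal, [(x, y)] dominates [(r - y + 1, y)], which is one step past the jump
   [(r - y, y)] of rank 0 and so has rank -1. *)
have : -1 <= rho (C x y) by case/andP: (h4 (C x y)).
have [_ j0 _] := J (r - y)%N y ltac:(lia).
have : rho (C x y) <= rho (C (r - y).+1 y).
  apply: h2 => j; rewrite !ffunE; case: eqP => _ //.
  by rewrite !inordK; lia.
rewrite j0; last by lia.
have := diag (r - y)%N ltac:(lia); rewrite subKn // => ->; lia.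
Qed.

End RankFunction.
End RankFunctionTheory.

(** * Slope structures near a point *)

Section Progress.
Variables (R : realType) (G : graph) (l : edge G -> R).
Hypothesis hl : metric_graph l.

Let l_gt0 : forall e, 0 < l e.
Proof. by case: hl. Qed.

Lemma go_go (x : realization l) eps k s : roomy x eps -> outgoing x k -> 0 < s <= eps ->
  [/\ outgoing (go x k s) k, outgoing (go x k s) (orev k),
      forall t, go (go x k s) k t = go x k (s + t) &
      forall t, go (go x k s) (orev k) t = go x k (s - t)].
Proof.
move=> hr hk /andP[s0 s1]; have e0 : 0 < eps by case: hr.
have hs : 0 < s <= 2 * eps by rewrite s0; lra.
have /andP[w0 w1] := roomy_valid hr hk hs.
set w := shift _ _ _ in w0 w1.
have vb b : valid l k.1 w b by rewrite /valid w0 w1 !ltW //; case: b.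
have hz : go x k s = pt l k.1 w by rewrite goE.
have o b : outgoing (pt l k.1 w) (k.1, b) by have [] := base_pt l_gt0 (vb b).
rewrite hz; split; [by have := o k.2; case: (k)|exact: o|move=> t|move=> t].
  have -> : go (pt l k.1 w) k t = pt l k.1 (shift k.2 w t).
    by have := go_pt l_gt0 t (vb k.2); case: (k).
  by rewrite goE /w /shift; case: k.2; rewrite ?opprD addrA.
rewrite (go_pt l_gt0) // goE /w /shift.
by case: k.2; rewrite /= ?opprB ?addrA // addrAC.
Qed.

End Progress.

Section SlopeStructureTheory.
Variables (R : realType) (G : graph) (l : edge G -> R) (r : nat).
Hypothesis hl : metric_graph l.
Variable SS : slope_data l r.

Let l_gt0 : forall e, 0 < l e.
Proof. by case: hl. Qed.

(** Takes a bare oriented edge, with default value 0 when it does not leave [x], so that points can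
    be rewritten without touching [tangent x]. *)
Definition slopes_along (x : realization l) (k : oedge G) (i : 'I_r.+1) : int :=
  if insub k is Some nu then mslopes SS (nu : tangent x) i else 0.

Lemma slopes_alongE (x : realization l) (nu : tangent x) i :
  mslopes SS nu i = slopes_along x (val nu) i.
Proof. by rewrite /slopes_along valK. Qed.

(** All is read in the model at [psi x], where directions correspond under [par]. Close to [psi x] a
    branch runs inside one edge of [H]: slopes are those of this edge, the reversed ones follow from
    [opp], and the rank is standard by [induced]. *)
Lemma slope_structure_theory : is_slope_structure SS ->
  [/\ forall x k, outgoing x k -> forall i j : 'I_r.+1, (i < j)%N ->
        slopes_along x k i < slopes_along x k j,
      forall x, rank_function (mrank SS (x := x)) &
      forall x k, outgoing x k -> exists2 eps, 0 < eps & forall s, 0 < s < eps ->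
        [/\ forall i, slopes_along (go x k s) k i = slopes_along x k i,
            forall i, slopes_along (go x k s) (orev k) i = - slopes_along x k (rev_ord i) &
            forall a, mrank SS (x := go x k s) a = standard_rank a]].
Proof.
case=> H [lH [phi [S [hphi [ind1 ind2 ind3]]]]].
have [hlH [psi phiK psiK] phi_dist] := hphi.
have lH_gt0 : forall e, 0 < lH e by case: hlH.
have ind y h k : outgoing y h -> outgoing (phi y) k -> par phi y h k ->
    forall i, slopes_along (phi y) k i = slopes S h i.
  move=> hh hk hpar i.
  by have := ind1 y (exist _ h hh) (exist _ k hk) hpar i; rewrite slopes_alongE.
case: S ind1 ind2 ind3 ind => sl rk simp incr opp hrk /= _ ind2 ind3 ind.
split.
- move=> x k; rewrite -(psiK x) => hk i j hij.
  have [h hh hpar] := par_surj hl hphi hk.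
  by rewrite !(ind _ h) //; apply: incr.
- move=> x; rewrite -(psiK x); case: (psi x) => [v|p]; last first.
    apply: (rank_function_ext (ind3 p)); exact: rank_function_standard.
  have [tau [[sig tK sK] tauP]] := tangent_bijection hl hphi (inl v).
  apply: (@rank_function_ext _ _ _ (fun b => rk v [ffun j => b (tau j)])).
    move=> a; apply: ind2 => h nu /tauP ->; by rewrite ffunE.
  by apply: rank_function_reindex; [exists sig|apply: hrk].
move=> x k; rewrite -(psiK x); set y := psi x => hk.
have [h hh [e e0 hpar]] := par_surj hl hphi hk.
have [e1 /andP[e10 e11] hr1] := common_roomy hlH y e0.
have [e2 /andP[e20 e21] hr2] := common_roomy hl (phi y) e10.
exists e2 => // s /andP[s0 s1].
have hs1 : 0 < s <= e1 by apply/andP; split; lra.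
have hs2 : 0 < s <= e2 by apply/andP; split; lra.
have [g1 g2 g3 g4] := go_go hl hr2 hk hs2.
have hgo : phi (go y h s) = go (phi y) k s by apply: hpar; apply/andP; split; lra.
have hsl i : slopes_along (phi y) k i = sl h i.
  by apply: ind => //; exists e.
have [o1 o2 o3 o4] := go_go hlH hr1 hh hs1.
have par1 : par phi (go y h s) h k.
  exists (e1 - s); first by lra.
  move=> t /andP[t0 t1]; rewrite o3 hgo g3 hpar //; apply/andP; split; lra.
have par2 : par phi (go y h s) (orev h) (orev k).
  exists s => // t /andP[t0 t1]; rewrite o4 hgo g4 hpar //; apply/andP; split; lra.
rewrite -hgo; split.
- by move=> i; rewrite (ind _ _ _ o1 _ par1) ?hgo // hsl.
- move=> i; rewrite (ind _ _ _ o2 _ par2) ?hgo // hsl.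
  by apply/eqP; rewrite -addr_eq0 addrC -{2}(rev_ordK i) opp.
have s2 : 0 < s <= 2 * e1 by apply/andP; split; lra.
have := roomy_valid hr1 hh s2.
rewrite goE => hw; rewrite (pt_interior hw); exact: ind3.
Qed.

End SlopeStructureTheory.
(* Real induction: the set of [w] up to which the comparison holds is closed
   and open to the right. *)
Lemma locally_constant_chain (R : realType) (T : Type) (Q : T -> T -> Prop)
    (Lf Rf : R -> T) (a b : R) : a < b ->
  (forall x, Q x x) -> (forall y x z, Q x y -> Q y z -> Q x z) ->
  (forall u, a <= u < b -> exists2 e, 0 < e &
     forall s, 0 < s < e -> Lf (u + s) = Rf u) ->
  (forall u, a < u <= b -> exists2 e, 0 < e &
     forall s, 0 < s < e -> Lf (u - s) = Lf u) ->
  (forall u, a < u < b -> Q (Lf u) (Rf u)) ->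
  Q (Rf a) (Lf b).
Proof.
move=> ab Qr Qt hR hL hQ.
pose A := [set w | a < w <= b /\ forall z, a < z <= w -> Q (Rf a) (Lf z)]%classic.
have step u : a <= u < b -> Q (Rf a) (Rf u) -> exists2 w, u < w <= b &
    forall z, u < z <= w -> Q (Rf a) (Lf z).
  case/andP=> au ub qu; have [|e e0 he] := hR u; first by rewrite au.
  exists (Num.min (u + e / 2) b).
    by rewrite lt_min ub ge_min lexx orbT; apply/andP; split => //; lra.
  move=> z /andP[uz]; rewrite le_min => /andP[ze zb].
  have -> : z = u + (z - u) by lra.
  by rewrite he //; apply/andP; split; lra.
have [w0 /andP[aw0 w0b] hw0] := step a (introT andP (conj (lexx a) ab)) (Qr _).
have Aw0 : A w0 by split; rewrite ?aw0.
have hsup : has_sup A.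
  by split; [exists w0|exists b => w [/andP[]]].
have ac : a < sup A by apply: lt_le_trans aw0 _; apply: sup_upper_bound.
have cb : sup A <= b by apply: ge_sup => [|w [/andP[]]//]; exists w0.
have below z : a < z < sup A -> Q (Rf a) (Lf z).
  case/andP=> az zc; have [|w [_ hw] zw] := sup_gt _ zc; first by exists w0.
  by apply: hw; rewrite az ltW.
have atc : Q (Rf a) (Lf (sup A)).
  have [|e e0 he] := hL (sup A); first by rewrite ac.
  have m0 : 0 < Num.min e (sup A - a) by rewrite lt_min e0 subr_gt0.
  have me : Num.min e (sup A - a) <= e by rewrite ge_min lexx.
  have ma : Num.min e (sup A - a) <= sup A - a by rewrite ge_min lexx orbT.
  rewrite -(he (Num.min e (sup A - a) / 2)); last by apply/andP; split; lra.
  by apply: below; apply/andP; split; lra.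
have [cltb|bc|<- //] := ltgtP (sup A) b; last by have := lt_le_trans bc cb; rewrite ltxx.
have [||w /andP[cw wb] hw] := step (sup A); first by rewrite ltW.
  by apply: Qt atc (hQ _ _); rewrite ac.
have : A w.
  split=> [|z /andP[az zw]]; first by rewrite (lt_trans ac cw).
  case: (ltgtP z (sup A)) => [zc|cz|-> //]; last by apply: hw; rewrite cz.
  by apply: below; rewrite az.
by move/(sup_upper_bound hsup)/(lt_le_trans cw); rewrite ltxx.
Qed.

(** * Slopes of functions in [RatD D] *)

Section Slopes.
Variables (R : realType) (G : graph) (l : edge G -> R).
Hypothesis hl : metric_graph l.

Let l_gt0 : forall e, 0 < l e.
Proof. by case: hl. Qed.

Variable f : realization l -> R.

Definition slope_along (x : realization l) (k : oedge G) : int :=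
  if insub k is Some nu then slope f (nu : tangent x) else 0.

Lemma slope_alongE (x : realization l) (nu : tangent x) : slope f nu = slope_along x (val nu).
Proof. by rewrite /slope_along valK. Qed.

(** [slope] is a chosen value; evaluating two candidates at a common positive [s] shows that there
    is only one. *)
Lemma slope_along_eq x k (m : int) eps : outgoing x k -> 0 < eps ->
  (forall s, 0 <= s < eps -> f (go x k s) = f x + m%:~R * s) -> slope_along x k = m.
Proof.
move=> hk e0 he; rewrite /slope_along (insubT (outgoing x) hk).
apply: xget_unique; first by exists eps.
move=> m' [e' e'0 he'].
have m0 : 0 < Num.min eps e' by rewrite lt_min e0.
have h1 : Num.min eps e' <= eps by rewrite ge_min lexx.
have h2 : Num.min eps e' <= e' by rewrite ge_min lexx orbT.
have s1 : 0 <= Num.min eps e' / 2 < eps by apply/andP; split; lra.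
have s2 : 0 <= Num.min eps e' / 2 < e' by apply/andP; split; lra.
have := he _ s1; have := he' _ s2; rewrite /travel /= -/(go _ _ _) => -> /addrI.
have m20 : Num.min eps e' / 2 != 0 by rewrite gt_eqF //; lra.
by move/(mulIf m20)/intr_inj.
Qed.

Lemma sum_tangent (x : realization l) (F : oedge G -> int) :
  \sum_(nu : tangent x) F (val nu) = \sum_(k | outgoing x k) F k.
Proof. exact: (esym (big_sub (outgoing x) F)). Qed.

Definition slopeR e u := slope_along (pt l e u) (e, true).
(** With the minus sign both one-sided slopes refer to increasing coordinates, so concavity reads
    [slopeR <= slopeL]. *)
Definition slopeL e u := - slope_along (pt l e u) (e, false).

Lemma ord_at_interior e u : 0 < u < l e ->
  ord_at f (pt l e u) = slopeL e u - slopeR e u.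
Proof.
move=> hu; rewrite /ord_at.
under eq_bigr do rewrite slope_alongE.
rewrite (sum_tangent _ (slope_along (pt l e u))) (eq_bigl (fun k => k.1 == e)); last first.
  by move=> k; rewrite (pt_interior hu).
rewrite (bigD1 (e, true)) //= (big_pred1 (e, false)); last first.
  by case=> e' b /=; rewrite !xpair_eqE; case: (e' == e); case: b.
by rewrite /slopeL /slopeR opprD addrC.
Qed.

Section Pieces.
Hypothesis hf : RatFun f.

Lemma knots_le k (t : nat -> R) a b i j : knots a b k t -> (i <= j <= k)%N -> t i <= t j.
Proof.
case=> _ _ ht /andP[]; elim: j => [|j IH]; first by rewrite leqn0 => /eqP ->.
rewrite leq_eqVlt => /orP[/eqP -> //|ij] jk.
by apply: le_trans (IH ij (ltnW jk)) (ltW (ht _ jk)).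
Qed.

Lemma knots_find k (t : nat -> R) a b u : knots a b k t -> a <= u < b ->
  exists2 i, (i < k)%N & t i <= u < t i.+1.
Proof.
case=> <- <- ht; elim: k ht => [|k IH] ht /andP[h1 h2].
  by have := le_lt_trans h1 h2; rewrite ltxx.
have [h|h] := ltP u (t k); last by exists k; rewrite // h.
have [|i ik hi] := IH (fun i ik => ht i (ltnW ik)); first by rewrite h1.
by exists i => //; apply: ltnW.
Qed.

Lemma knots_find_left k (t : nat -> R) a b u : knots a b k t -> a < u <= b ->
  exists2 i, (i < k)%N & t i < u <= t i.+1.
Proof.
case=> <- <- ht; elim: k ht => [|k IH] ht /andP[h1 h2].
  by have := lt_le_trans h1 h2; rewrite ltxx.
have [h|h] := leP u (t k); last by exists k; rewrite // h.
have [|i ik hi] := IH (fun i ik => ht i (ltnW ik)); first by rewrite h1.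
by exists i => //; apply: ltnW.
Qed.

(** Replaces the unspecified integers of [RatFun] by slopes of [f]. The half-open ranges make every
    knot belong to the piece on its right for [slopeR] and on its left for [slopeL]. *)
Lemma slope_pieces e : exists k t, [/\ knots 0 (l e) k t,
  forall i u, (i < k)%N -> t i <= u <= t i.+1 ->
    f (pt l e u) = f (pt l e (t i)) + (slopeR e (t i))%:~R * (u - t i),
  forall i u, (i < k)%N -> t i <= u < t i.+1 -> slopeR e u = slopeR e (t i) &
  forall i u, (i < k)%N -> t i < u <= t i.+1 -> slopeL e u = slopeR e (t i)].
Proof.
have [k [t [m [hk hm]]]] := hf e; have [t0 tk ht] := hk.
have tlo i : (i < k)%N -> 0 <= t i.
  by move=> ik; rewrite -t0; apply: knots_le hk _; rewrite /= ltnW.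
have thi i : (i < k)%N -> t i.+1 <= l e.
  by move=> ik; rewrite -tk; apply: knots_le hk _; rewrite ik /=.
have rR i u : (i < k)%N -> t i <= u < t i.+1 -> slopeR e u = m i.
  move=> ik /andP[u1 u2]; have := tlo _ ik; have := thi _ ik => h1 h2.
  have hv : valid l e u true by apply/andP; split; lra.
  have [ho _] := base_pt l_gt0 hv.
  apply: (@slope_along_eq _ _ _ (t i.+1 - u)) => //; first by lra.
  move=> s /andP[s0 s1]; rewrite (go_pt l_gt0) // /shift.
  rewrite (hm i (u + s)) ?(hm i u) //; try (apply/andP; split; lra).
  by ring.
have rL i u : (i < k)%N -> t i < u <= t i.+1 -> slopeL e u = m i.
  move=> ik /andP[u1 u2]; have := tlo _ ik; have := thi _ ik => h1 h2.
  have hv : valid l e u false by apply/andP; split; lra.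
  have [ho _] := base_pt l_gt0 hv.
  rewrite /slopeL (@slope_along_eq _ _ (- m i) (u - t i)) ?opprK //; first by lra.
  move=> s /andP[s0 s1]; rewrite (go_pt l_gt0) // /shift.
  rewrite (hm i (u - s)) ?(hm i u) //; try (apply/andP; split; lra).
  by rewrite rmorphN /=; ring.
exists k, t; split=> // [i u ik hu|i u ik hu|i u ik hu].
- by rewrite (rR i (t i)) ?lexx ?ht //; apply: hm.
- by rewrite !(rR i) ?lexx ?ht.
- by rewrite (rL i) ?(rR i) ?lexx ?ht.
Qed.

Lemma slopeR_local e u : 0 <= u < l e -> exists2 eps, 0 < eps &
  forall s, 0 < s < eps -> slopeL e (u + s) = slopeR e u.
Proof.
have [k [t [hk _ hR hL]]] := slope_pieces e.
move=> /(knots_find hk)[i ik hu]; rewrite (hR i) //; move/andP: hu => [u1 u2].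
exists (t i.+1 - u); first by rewrite subr_gt0.
by move=> s /andP[s0 s1]; apply: hL ik _; apply/andP; split; lra.
Qed.

Lemma slopeL_local e u : 0 < u <= l e -> exists2 eps, 0 < eps &
  forall s, 0 < s < eps -> slopeL e (u - s) = slopeL e u.
Proof.
have [k [t [hk _ hR hL]]] := slope_pieces e.
move=> /(knots_find_left hk)[i ik hu]; rewrite (hL i) //; move/andP: hu => [u1 u2].
exists (u - t i); first by rewrite subr_gt0.
by move=> s /andP[s0 s1]; apply: hL ik _; apply/andP; split; lra.
Qed.

End Pieces.

Variable D : divisor l.
Hypothesis hD : supported_on_vertices D.
Hypothesis hf : RatD D f.

(** [D] vanishes inside an edge, so effectivity of [D + div f] leaves just the difference of the two
    slopes. *)
Lemma slopeR_le_slopeL e u : 0 < u < l e -> slopeR e u <= slopeL e u.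
Proof.
move=> hu; case: hf => _ /(_ (pt l e u)); rewrite ord_at_interior //.
suff -> : D (pt l e u) = 0 by rewrite add0r subr_ge0.
by apply/eqP/negPn/negP => /hD[v]; rewrite (pt_interior hu).
Qed.

(** Real induction with the relation [>=]: slopes are locally constant on each side of a point and
    can only drop across it. *)
Lemma slope_concave e u u' : 0 <= u -> u < u' -> u' <= l e -> slopeL e u' <= slopeR e u.
Proof.
move=> u0 uu' u'l; have [hrat _] := hf.
apply: (@locally_constant_chain _ int (fun x y => y <= x) (slopeL e) (slopeR e)) => //.
- by move=> y x z h1 h2; apply: le_trans h2 h1.
- move=> w /andP[w1 w2]; apply: slopeR_local => //; apply/andP; split; lra.
- move=> w /andP[w1 w2]; apply: slopeL_local => //; apply/andP; split; lra.
- move=> w /andP[w1 w2]; apply: slopeR_le_slopeL; apply/andP; split; lra.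
Qed.

(** By concavity the slope of every piece lies between the slopes at the two ends of [e]; this is
    summed over the pieces. *)
Lemma mean_slope e :
  (slopeL e (l e))%:~R * l e <= f (inl (tgt e)) - f (inl (src e)) <=
  (slopeR e 0)%:~R * l e.
Proof.
have [hrat _] := hf; have [k [t [hk hfe hR hL]]] := slope_pieces hrat e.
have [t0 tk ht] := hk; have le0 := l_gt0 e.
have -> : inl (src e) = pt l e (t 0%N) by rewrite t0 pt_src.
have -> : inl (tgt e) = pt l e (t k) by rewrite tk (pt_tgt l_gt0).
have : (k <= k)%N by [].
suff H i : (i <= k)%N ->
  (slopeL e (l e))%:~R * t i <= f (pt l e (t i)) - f (pt l e (t 0%N)) <=
  (slopeR e 0)%:~R * t i by move/H; rewrite tk.
elim: i => [_|i IH ik]; first by rewrite t0 !mulr0 subrr lexx.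
have := IH (ltnW ik); have := hfe i (t i.+1) ik.
have hi := ht _ ik; rewrite (ltW hi) lexx => /(_ isT) -> /andP[h1 h2].
have ti0 : 0 <= t i by rewrite -t0; apply: knots_le hk _; rewrite /= ltnW.
have til : t i.+1 <= l e by rewrite -tk; apply: knots_le hk _; rewrite ik /=.
have a1 : slopeL e (l e) <= slopeR e (t i) by apply: slope_concave; lra.
have a2 : slopeR e (t i) <= slopeR e 0.
  by rewrite -(hL i (t i.+1)) ?hi ?lexx //; apply: slope_concave; lra.
have b1 : (slopeL e (l e))%:~R * (t i.+1 - t i) <= (slopeR e (t i))%:~R * (t i.+1 - t i).
  by apply: ler_wpM2r; [rewrite subr_ge0 ltW|rewrite ler_int].
have b2 : (slopeR e (t i))%:~R * (t i.+1 - t i) <= (slopeR e 0)%:~R * (t i.+1 - t i).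
  by apply: ler_wpM2r; [rewrite subr_ge0 ltW|rewrite ler_int].
rewrite !mulrBr in b1 b2 *; apply/andP; split; lra.
Qed.

(** Bounds the total of [D] over any set of vertices, whatever sublevel set is used. *)
Definition slope_bound : int := \sum_v `|D (inl v)|.

(* Summing [D + div f >= 0] over the vertices of the sublevel set [f <= c],
   every edge contributes a nonnegative amount. *)
Lemma end_slopes_le c e :
  (f (inl (src e)) <= c)%R%:Z * slopeR e 0
  - (f (inl (tgt e)) <= c)%R%:Z * slopeL e (l e) <= slope_bound.
Proof.
pose chi v : int := (f (inl v) <= c)%R%:Z.
pose T e := chi (src e) * slopeR e 0 - chi (tgt e) * slopeL e (l e).
(* With both ends in the sublevel set this is concavity. With one end only, [f] grows towards the
   other end, and [mean_slope] gives the sign of the slope at the end inside. *)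
have T_ge0 e' : 0 <= T e'.
  have le0 := l_gt0 e'; have := mean_slope e'.
  have := slope_concave (lexx 0) le0 (lexx (l e')).
  rewrite /T /chi => h /andP[h1 h2].
  have [hs|hs] := leP (f (inl (src e'))) c; have [ht|ht] := leP (f (inl (tgt e'))) c;
    rewrite /= ?mul1r ?mul0r ?subr0 ?sub0r ?oppr_ge0 //.
  - by rewrite subr_ge0.
  - rewrite -(ler_int R) -(pmulr_lge0 _ le0); lra.
  - rewrite -(ler_int R) -(pmulr_lle0 _ le0); lra.
(* Double counting: the terms are regrouped by oriented edges, and later by their tails, where they
   add up to [- ord_at f]. *)
have sumT : \sum_e' T e' = \sum_(k : oedge G) chi (osrc k) * slope_along (inl (osrc k)) k.
  transitivity (\sum_(e' : edge G) \sum_(b : bool)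
      chi (osrc (e', b)) * slope_along (inl (osrc (e', b))) (e', b)); last first.
    by rewrite pair_bigA; apply: eq_bigr => -[].
  apply: eq_bigr => e' _; rewrite big_bool /= /osrc /= /T /slopeR /slopeL.
  by rewrite pt_src (pt_tgt l_gt0) mulrN opprK.
have : T e <= \sum_e' T e'.
  by rewrite (bigD1 e) //= lerDl; apply: sumr_ge0.
move/le_trans; apply; rewrite sumT.
rewrite (partition_big (@osrc G) predT) //=.
apply: ler_sum => v _.
have -> : \sum_(k | osrc k == v) chi (osrc k) * slope_along (inl (osrc k)) k
        = chi v * - ord_at f (inl v).
  rewrite /ord_at opprK; under [in RHS]eq_bigr do rewrite slope_alongE.
  rewrite (sum_tangent _ (slope_along (inl v))) mulr_sumr.
  by apply: eq_bigr => k /eqP ->.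
have := (hf.2 (inl v)); rewrite /chi; case: (f _ <= c)%R => /=; rewrite ?mul1r ?mul0r // => h.
by apply: le_trans (ler_norm _); lia.
Qed.

(** Interior slopes lie between the end slopes by concavity. The level [f (src e)] bounds
    [slopeR e 0] from above and the level [f (tgt e)] bounds [slopeL e (l e)] from below; if the
    other end is also in the sublevel set, its term has the favourable sign. *)
Lemma slopes_bounded e u : 0 < u < l e ->
  `|slopeR e u| <= slope_bound /\ `|slopeL e u| <= slope_bound.
Proof.
move=> hu; have /andP[u0 ul] := hu; have le0 := l_gt0 e.
have c1 := slope_concave (lexx 0) u0 (ltW ul).
have c2 := slope_concave (ltW u0) ul (lexx _).
have c3 := slopeR_le_slopeL hu.
have /andP[m1 m2] := mean_slope e.
have e1 : slopeR e 0 <= slope_bound.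
  have := end_slopes_le (f (inl (src e))) e; rewrite lexx mul1r.
  case: (leP (f (inl (tgt e)))) => /= h; rewrite ?mul1r ?mul0r; last by rewrite subr0.
  have : slopeL e (l e) <= 0 by rewrite -(ler_int R) -(pmulr_lle0 _ le0); lra.
  lia.
have e2 : - slopeL e (l e) <= slope_bound.
  have := end_slopes_le (f (inl (tgt e))) e; rewrite lexx mul1r.
  case: (leP (f (inl (src e)))) => /= h; rewrite ?mul1r ?mul0r; last by rewrite sub0r.
  have : 0 <= slopeR e 0 by rewrite -(ler_int R) -(pmulr_lge0 _ le0); lra.
  lia.
move: c1 c2 c3 e1 e2.
move: (slopeR e 0) (slopeR e u) (slopeL e u) (slopeL e (l e)) slope_bound.
move=> a b c d B; clear => *; rewrite !ler_norml.
by split; apply/andP; split; lia.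
Qed.

End Slopes.

(** * Slope structures of admissible semimodules *)

Lemma two_point_divisor (R : realType) (G : graph) (l : edge G -> R)
    (x y : realization l) (i j : nat) : x != y ->
  exists E : divisor l, [/\ effective E, degree E = i%:Z + j%:Z, E x = i & E y = j].
Proof.
move=> xy.
pose E : divisor l :=
  [fsfun z in [fset x; y]%fset => if z == x then i%:Z else j%:Z].
have Ex : E x = i by rewrite fsfunE !inE eqxx.
have Ey : E y = j by rewrite fsfunE !inE eqxx orbT eq_sym (negbTE xy).
exists E; split=> //.
  by move=> z; rewrite fsfunE; case: ifP => // _; case: ifP.
rewrite /degree (@big_fset_incl _ _ _ _ _ [fset x; y]%fset).
- by rewrite big_fsetU1 ?inE //= big_seq_fset1 Ex Ey.
- by apply/fsubsetP => z; rewrite mem_finsupp fsfunE; case: ifP => //; rewrite eqxx.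
- by move=> z _; rewrite mem_finsupp negbK => /eqP.
Qed.

Section AdmissibleSlopes.
Variables (R : realType) (G : graph) (l : edge G -> R).
Hypothesis hl : metric_graph l.
Variable D : divisor l.
Hypothesis hD : supported_on_vertices D.
Variables (r : nat) (SS : slope_data l r) (M : set (realization l -> R)).
Hypothesis hM : admissible D SS M.

Let l_gt0 : forall e, 0 < l e.
Proof. by case: hl. Qed.

Let hSS : is_slope_structure SS.
Proof. by case: hM => _ _ _ []. Qed.

Lemma slopes_along_lt x k (i j : 'I_r.+1) :
  outgoing x k -> (i < j)%N -> slopes_along SS x k i < slopes_along SS x k j.
Proof. by move=> hk; have [h _ _] := slope_structure_theory hl hSS; apply: h. Qed.

Lemma slopes_along_le x k (i j : 'I_r.+1) : outgoing x k ->
  (slopes_along SS x k i <= slopes_along SS x k j) = (i <= j)%N.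
Proof.
move=> hk; case: (ltngtP i j) => [ij|ji|/val_inj ->].
- by rewrite ltW // slopes_along_lt.
- by apply/negbTE; rewrite -ltNge slopes_along_lt.
- by rewrite lexx.
Qed.

Lemma mrank_rank_function x : rank_function (mrank SS (x := x)).
Proof. by have [_ h _] := slope_structure_theory hl hSS. Qed.

Lemma slopes_along_local x k : outgoing x k -> exists2 eps, 0 < eps & forall s, 0 < s < eps ->
  [/\ forall i, slopes_along SS (go x k s) k i = slopes_along SS x k i,
      forall i, slopes_along SS (go x k s) (orev k) i = - slopes_along SS x k (rev_ord i) &
      forall a, mrank SS (x := go x k s) a = standard_rank a].
Proof. by have [_ _ h] := slope_structure_theory hl hSS; apply: h. Qed.

(** The test divisor is [i x + j y]; by [rank_le_axis], a rank of at least [E z] caps all indices at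
    [z] by [r - E z]. *)
Lemma admissible_witness (x y : realization l) (i j : nat) : x != y -> (i + j = r)%N ->
  exists2 f, RatD D f /\ compatible SS f & forall z,
    exists2 a : {ffun tangent z -> 'I_r.+1},
      (forall nu, slope_along f z (val nu) = slopes_along SS z (val nu) (a nu)) &
      forall nu, (z = x -> (a nu <= r - i)%N) /\ (z = y -> (a nu <= r - j)%N).
Proof.
move=> xy hij; have [E [hE dE Ex Ey]] := two_point_divisor i j xy.
case: hM => _ _ _ [_ hMD] hadm.
have [|f Mf [hf _]] := hadm E hE; first by rewrite dE -hij PoszD.
exists f; first exact: hMD Mf.
move=> z; have [a ha hz] := hf z; exists a => nu; first by rewrite -slope_alongE -slopes_alongE.
have H := le_trans hz (rank_le_axis (mrank_rank_function z) a nu).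
by split=> e; have /= ez := congr1 (fun w => E w) e;
  move: H; rewrite ez ?Ex ?Ey; move: (nat_of_ord _) => m; lia.
Qed.

(** Slopes are constant along a short branch, so they can be tested at an interior point [z] of it.
    The divisor [r z] forces all indices at [z] to be 0: the function has slope [s_0] along [k] and
    [- s_r] backwards, both bounded, and the other [s_i] lie between [s_0] and [s_r]. *)
Lemma slopes_along_bounded x k i : outgoing x k -> `|slopes_along SS x k i| <= slope_bound D.
Proof.
move=> hk; have [e e0 hloc] := slopes_along_local hk.
have [s /andP[s0 s1] hr] := common_roomy hl x e0.
have hs : 0 < s < e by rewrite s0.
have [eq1 eq2 _] := hloc s hs.
have hs2 : 0 < s <= s by rewrite s0 lexx.
have [o1 o2 _ _] := go_go hl hr hk hs2.
have hs3 : 0 < s <= 2 * s by rewrite s0; lra.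
have hw := roomy_valid hr hk hs3.
(* The vertex is just a second point to which the test divisor gives multiplicity 0. *)
have yv : go x k s != inl (src k.1) by rewrite goE (pt_interior hw).
have [f [fD _] hf] := admissible_witness yv (addn0 r).
have [a ha /= a0] := hf (go x k s).
have za nu : a nu = ord0.
  by apply/val_inj/eqP; have [/(_ erefl)] := a0 nu; rewrite subnn leqn0.
have b1 : `|slopes_along SS x k ord0| <= slope_bound D.
  rewrite -eq1 -(za (exist _ k o1)) -(ha (exist _ k o1)) /= goE.
  have [b1 b2] := slopes_bounded hl hD fD hw.
  rewrite /slopeR /slopeL normrN in b1 b2.
  by case: k {hk hloc hr eq1 eq2 o1 o2 hw yv hf a ha a0 za} b1 b2 => f' [].
have b2 : `|slopes_along SS x k (rev_ord ord0)| <= slope_bound D.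
  rewrite -normrN -eq2 -(za (exist _ (orev k) o2)) -(ha (exist _ (orev k) o2)) /= goE.
  have [b1' b2] := slopes_bounded hl hD fD hw.
  rewrite /slopeR /slopeL normrN in b1' b2.
  by case: k {hk hloc hr eq1 eq2 o1 o2 hw yv hf a ha a0 za b1} b1' b2 => f' [].
have m1 : slopes_along SS x k ord0 <= slopes_along SS x k i by rewrite slopes_along_le.
have m2 : slopes_along SS x k i <= slopes_along SS x k (rev_ord ord0).
  by rewrite slopes_along_le //= subSS subn0 -ltnS.
move: b1 b2 m1 m2; rewrite !ler_norml.
move: (slopes_along _ _ _ _) (slopes_along _ _ _ _) (slopes_along _ _ _ _).
move: (slope_bound D) => B p q t.
clear; lia.
Qed.

Definition right_slopes e u i := slopes_along SS (pt l e u) (e, true) i.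
(** The sign turns the slopes towards increasing coordinates, and [rev_ord] restores their
    increasing order. *)
Definition left_slopes e u i := - slopes_along SS (pt l e u) (e, false) (rev_ord i).

Lemma right_slopes_local e u : 0 <= u < l e -> exists2 eps, 0 < eps &
  forall s, 0 < s < eps -> forall i, left_slopes e (u + s) i = right_slopes e u i.
Proof.
move=> hu; have [ho _] := @base_pt _ _ _ l_gt0 e u true hu.
have [eps e0 he] := slopes_along_local ho; exists eps => // s /he[_ h _] i.
by rewrite /left_slopes; move: h; rewrite (go_pt l_gt0) //= => ->; rewrite rev_ordK opprK.
Qed.

Lemma left_slopes_local e u : 0 < u <= l e -> exists2 eps, 0 < eps &
  forall s, 0 < s < eps -> forall i, left_slopes e (u - s) i = left_slopes e u i.
Proof.
move=> hu; have [ho _] := @base_pt _ _ _ l_gt0 e u false hu.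
have [eps e0 he] := slopes_along_local ho; exists eps => // s /he[h _ _] i.
by rewrite /left_slopes; move: h; rewrite (go_pt l_gt0) //= => ->.
Qed.

(* Testing against [i (x + eps) + (r - i) (x - eps)] gives a function whose slope
   vector at [x] has indices at least [i] and [r - i]; concavity does the rest. *)
Lemma slopes_at_interior e u (i : 'I_r.+1) (hu : 0 < u < l e)
    (oR : outgoing (pt l e u) (e, true)) (oL : outgoing (pt l e u) (e, false)) :
  exists2 a : {ffun tangent (pt l e u) -> 'I_r.+1}, jump (mrank SS (x := pt l e u)) a &
    let aR := a (exist _ (e, true) oR) in let aL := a (exist _ (e, false) oL) in
    right_slopes e u i <= right_slopes e u aR /\
    (right_slopes e u aR <= left_slopes e u (rev_ord aL) /\
     left_slopes e u (rev_ord aL) <= left_slopes e u i).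
Proof.
have /andP[u0 ul] := hu.
have hv b : valid l e u b by rewrite /valid u0 ul !ltW //; case: b.
have [e1 e10 loc1] := slopes_along_local oR; have [e2 e20 loc2] := slopes_along_local oL.
have e0 : 0 < Num.min e1 e2 by rewrite lt_min e10.
have [s /andP[s0]] := common_roomy hl (pt l e u) e0.
rewrite lt_min => /andP[s1 s2] hr.
have [eq1 eqo1 _] := loc1 s (introT andP (conj s0 s1)).
have [eq2 eqo2 _] := loc2 s (introT andP (conj s0 s2)).
have hs : 0 < s <= s by rewrite s0 lexx.
have [_ o1 _ _] := go_go hl hr oR hs.
have [_ o2 _ _] := go_go hl hr oL hs.
have hs3 : 0 < s <= 2 * s by rewrite s0; lra.
have /andP[w1 w2] := roomy_valid hr oR hs3.
have /andP[w3 w4] := roomy_valid hr oL hs3.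
rewrite /orev /= in eqo1 eqo2 o1 o2.
rewrite !(go_pt l_gt0) // /shift /= in eq1 eq2 eqo1 eqo2 o1 o2.
rewrite /shift /= !(base_pt l_gt0 _).2 // in w1 w2 w3 w4.
have neq : pt l e (u + s) != pt l e (u - s).
  apply/eqP => /(pt_inj l_gt0 (introT andP (conj w1 w2))) []; last by move=> _; lra.
  by rewrite !ltW.
have ir : (i <= r)%N by rewrite -ltnS.
have [f [fD fc] hf] := admissible_witness neq (subnKC ir).
have [a [ja ha]] := fc (pt l e u); exists a => //=.
have sR : slopeR f e u = right_slopes e u (a (exist _ (e, true) oR)).
  by have := ha (exist _ (e, true) oR); rewrite slope_alongE slopes_alongE.
have sL : slopeL f e u = left_slopes e u (rev_ord (a (exist _ (e, false) oL))).
  have := ha (exist _ (e, false) oL).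
  by rewrite slope_alongE slopes_alongE /left_slopes rev_ordK => <-.
split; last split.
(* At [u + s] the direction back to [x] has index at most [r - i]; read forwards, its slope has
   index at least [i]. *)
- have [a1 ha1 le1] := hf (pt l e (u + s)).
  have := ha1 (exist _ (e, false) o1); rewrite /= eqo1 => h1.
  have c : slopeL f e (u + s) <= slopeR f e u.
    by apply: (slope_concave hl hD fD); rewrite ?ltrDl ?ltW.
  rewrite -sR; apply: le_trans c; rewrite /slopeL h1 opprK slopes_along_le //=.
  have [/(_ erefl) + _] := le1 (exist _ (e, false) o1); rewrite subSS.
  by move: (nat_of_ord (a1 _)) ir; move: (nat_of_ord i); clear => n m; lia.
- by rewrite -sR -sL; exact: (slopeR_le_slopeL hD fD hu).
(* At [u - s] the multiplicity is [r - i], so the slope towards [x] has index at most [i]. *)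
- have [a2 ha2 le2] := hf (pt l e (u - s)).
  have := ha2 (exist _ (e, true) o2); rewrite /= eqo2 => h2.
  have c : slopeL f e u <= slopeR f e (u - s).
    by apply: (slope_concave hl hD fD); rewrite ?gtrBl ?ltW.
  rewrite -sL; apply: le_trans c _; rewrite /slopeR h2 lerN2 slopes_along_le //=.
  have [_ /(_ erefl)] := le2 (exist _ (e, true) o2); rewrite subKn //.
  by rewrite !subSS => h; apply: leq_sub2l.
Qed.

Lemma interior_tangents e u (hu : 0 < u < l e) :
  outgoing (pt l e u) (e, true) /\ outgoing (pt l e u) (e, false).
Proof. by rewrite (pt_interior hu) /=. Qed.

Lemma right_slopes_le_left_slopes e u i : 0 < u < l e -> right_slopes e u i <= left_slopes e u i.
Proof.
move=> hu; have [oR oL] := interior_tangents hu.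
by have [a _ /= [h1 [h2 h3]]] := slopes_at_interior i hu oR oL; apply: le_trans h1 (le_trans h2 h3).
Qed.

(** When the two families of slopes agree, the inequalities of [slopes_at_interior] become
    equalities: the jump found there is [(i, r - i)]. Hence all antidiagonal points are jumps. *)
Lemma rank_standard_at e u : 0 < u < l e ->
  (forall i, right_slopes e u i = left_slopes e u i) ->
  forall a, mrank SS (x := pt l e u) a = standard_rank a.
Proof.
move=> hu hRL; have [oR oL] := interior_tangents hu.
have right_slopes_le i j : (right_slopes e u i <= right_slopes e u j) = (i <= j)%N.
  exact: slopes_along_le.
pose nuR : tangent (pt l e u) := exist _ (e, true) oR.
pose nuL : tangent (pt l e u) := exist _ (e, false) oL.
have two (nu : tangent (pt l e u)) : nu = nuR \/ nu = nuL.
  have : (val nu).1 = e by have := valP nu; rewrite {1}(pt_interior hu) => /eqP.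
  by case hk : (val nu) => [e' []] /= he; [left|right]; apply: val_inj; rewrite hk he.
apply: (rank_standard_of_jumps (mrank_rank_function _) (i0 := nuR) (i1 := nuL)) => //.
  by apply/eqP => /(congr1 val) [].
move=> a' ha'; have [a ja /= [h1 [h2 h3]]] := slopes_at_interior (a' nuR) hu oR oL.
rewrite -!hRL !right_slopes_le in h1 h2 h3.
have -> // : a' = a.
have aR : a nuR = a' nuR by apply/val_inj/eqP; rewrite eqn_leq h1 (leq_trans h2 h3).
apply/ffunP => nu; case: (two nu) => -> //; apply: ord_inj.
move: h2 h3; rewrite -/nuL -/nuR aR /= subSS => h2 h3.
have arith (x y z : nat) : (x <= r - z)%N -> (r - z <= x)%N -> (x + y = r)%N ->
    (z < r.+1)%N -> y = z by clear; lia.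
exact: arith h2 h3 ha' (ltn_ord (a nuL)).
Qed.

(** Real induction again: each [s_i] is constant near a point on either side and can only drop
    across it. *)
Lemma left_slopes_le_right_slopes e a b i :
  0 <= a -> a < b -> b <= l e -> left_slopes e b i <= right_slopes e a i.
Proof.
move=> a0 ab bl.
apply: (@locally_constant_chain _ int (fun x y => y <= x)
  (left_slopes e ^~ i) (right_slopes e ^~ i)) => //.
- by move=> y x z h1 h2; apply: le_trans h2 h1.
- move=> w /andP[w1 w2]; have [|eps e0 he] := @right_slopes_local e w.
    by apply/andP; split; lra.
  by exists eps => // s hs; apply: he.
- move=> w /andP[w1 w2]; have [|eps e0 he] := @left_slopes_local e w.
    by apply/andP; split; lra.
  by exists eps => // s hs; apply: he.
- move=> w /andP[w1 w2]; apply: right_slopes_le_left_slopes; apply/andP; split; lra.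
Qed.

(** The rank does not appear: by [rank_standard_at] it is standard at every other interior point.
    Hence these are the points at which a vertex must be placed. *)
Definition break_point e u := 0 < u < l e /\ exists i, right_slopes e u i <> left_slopes e u i.

Lemma slopes_constant e a b i : 0 <= a -> a < b -> b <= l e ->
  (forall u, a < u < b -> ~ break_point e u) -> left_slopes e b i = right_slopes e a i.
Proof.
move=> a0 ab bl nb; apply/esym.
apply: (@locally_constant_chain _ int eq
  (left_slopes e ^~ i) (right_slopes e ^~ i)) => //.
- by move=> y x z -> ->.
- move=> w /andP[w1 w2]; have [|eps e0 he] := @right_slopes_local e w.
    by apply/andP; split; lra.
  by exists eps => // s hs; apply: he.
- move=> w /andP[w1 w2]; have [|eps e0 he] := @left_slopes_local e w.
    by apply/andP; split; lra.
  by exists eps => // s hs; apply: he.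
- move=> w hw; apply/eqP/negPn/negP => hne; apply: (nb w hw); split.
    by case/andP: hw => w1 w2; apply/andP; split; lra.
  by exists i => h; rewrite h eqxx in hne.
Qed.

(** A sum of [r + 1] slopes bounded by [slope_bound D] lies in an interval of this length. *)
Definition break_bound := (2 * (r.+1 * `|slope_bound D|))%N.

(** In increasing order of the points, the sum of all slopes falls by at least one at each of them
    and does not grow in between, while it stays in a bounded interval. *)
Lemma break_points_bounded e (s : seq R) : uniq s ->
  (forall u, u \in s -> break_point e u) -> (size s <= break_bound)%N.
Proof.
rewrite -sort_lt_sorted -(size_sort <=%R) => hs hb.
have {}hb u : u \in sort <=%R s -> break_point e u by rewrite mem_sort; apply: hb.
move: (sort _ _) hs hb => [|u t] //=.
pose sR w := \sum_i right_slopes e w i; pose sL w := \sum_i left_slopes e w i.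
have drop w : break_point e w -> sR w + 1 <= sL w.
  case=> hw [i hi]; rewrite -ltzD1 ltrD2r /sR /sL.
  rewrite (bigD1 i) // [X in _ < X](bigD1 i) //=.
  apply: ltr_leD; last by apply: ler_sum => j _; apply: right_slopes_le_left_slopes.
  by rewrite lt_neqAle right_slopes_le_left_slopes // andbT; apply/eqP.
have chain : forall t u, path <%R u t -> (forall w, w \in u :: t -> break_point e w) ->
    sR (last u t) + (size t).+1%:Z <= sL u.
  elim=> [|w t' IH] u' /=; first by move=> _ /(_ u'); rewrite mem_head => /(_ isT) /drop.
  case/andP=> uw hp hb; have {}IH := IH w hp (fun x hx => hb x (mem_behead (s := _ :: _) hx)).
  move: IH.
  have bu : break_point e u' by apply: hb; rewrite mem_head.
  have bw : break_point e w by apply: hb; rewrite !inE eqxx orbT.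
  have : sL w <= sR u'.
    case: bu bw => /andP[u1 _] _ [/andP[_ w1] _].
    by apply: ler_sum => i _; apply: left_slopes_le_right_slopes => //; exact: ltW.
  move: (drop _ bu) (size t') => /=.
  by move: (sR (last w t')) (sR u') (sL w) (sL u'); clear => *; lia.
move=> hp hb; have := chain t u hp hb.
set v := last u t.
have [hv _] : break_point e v by apply: hb; rewrite /v mem_last.
have [hu _] : break_point e u by apply: hb; rewrite mem_head.
have [ou1 ou2] := interior_tangents hu; have [ov1 ov2] := interior_tangents hv.
have bR : - (\sum_(i < r.+1) slope_bound D) <= sR v.
  rewrite -sumrN; apply: ler_sum => i _.
  by have := slopes_along_bounded i ov1; rewrite ler_norml => /andP[].
have bL : sL u <= \sum_(i < r.+1) slope_bound D.
  apply: ler_sum => i _.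
  by have := slopes_along_bounded (rev_ord i) ou2; rewrite ler_norml /left_slopes lerNl => /andP[].
move: bR bL; rewrite sumr_const card_ord /break_bound => bR bL h.
have B0 : 0 <= slope_bound D by apply: sumr_ge0.
move: B0 bR bL h; move: (sR v) (sL u) (slope_bound D) (size t); clear.
move=> a b B n B0; rewrite -mulr_natr; move: B0; case: B => // B _.
nia.
Qed.

End AdmissibleSlopes.

(** A duplicate-free list in [P] of maximal length contains all of [P]. Padding it to exactly [N]
    points makes the number of subdivision vertices independent of [P]. *)
Lemma exists_marking (R : realType) (L : R) (P : R -> Prop) (K N : nat) : 0 < L ->
  (forall u, P u -> 0 < u < L) -> (K <= N)%N ->
  (forall s, uniq s -> (forall u, u \in s -> P u) -> (size s <= K)%N) ->
  exists s : seq R, [/\ sorted <%R s, size s = N, forall u, u \in s -> 0 < u < L &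
    forall u, P u -> u \in s].
Proof.
move=> L0 PL KN hK.
pose Q n := `[< exists s, [/\ uniq s, forall u, u \in s -> P u & size s = n] >].
have Qex : exists n, Q n by exists 0%N; apply/asboolP; exists [::].
have Qle n : Q n -> (n <= K)%N by move/asboolP=> [s [us hs <-]]; apply: hK.
have [n /asboolP[s [us hs hsz]] nmax] := ex_maxnP Qex Qle.
have Ps u : P u -> u \in s.
  move=> Pu; apply/negPn/negP => us'.
  have /nmax : Q n.+1; last by rewrite ltnn.
  apply/asboolP; exists (u :: s); split; rewrite /= ?us' ?hsz //.
  by move=> w; rewrite inE => /orP[/eqP ->|/hs].
have {}hsz : (size s <= N)%N.
  by apply: leq_trans KN; rewrite hsz; apply: Qle; apply/asboolP; exists s.
have sL u : u \in s -> 0 < u < L by move/hs/PL.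
have pad d : forall s : seq R, (size s + d = N)%N -> uniq s ->
    (forall u, u \in s -> 0 < u < L) ->
    exists s', [/\ uniq s', size s' = N, forall u, u \in s' -> 0 < u < L & {subset s <= s'}].
  elim: d => [|d IH] t hd ut ht; first by exists t; split=> //; rewrite -hd addn0.
  have [w hw wt] : exists2 w, 0 < w < L & w \notin t.
    (* Half of the smallest listed point, or of [L] for an empty list, is a new point. *)
    pose m := \big[Num.min/L]_(u <- t) u.
    have m0 : 0 < m /\ m <= L.
      rewrite /m; elim: t ht {hd ut m} => [|u t IHt] ht; first by rewrite big_nil.
      rewrite big_cons lt_min ge_min.
      have [|h1 h2] := IHt; first by move=> v hv; apply: ht; rewrite inE hv orbT.
      have /andP[u0 _] := ht u (mem_head _ _); by rewrite u0 h1 h2 orbT.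
    exists (m / 2); first by case: m0 => h1 h2; apply/andP; split; lra.
    apply/negP => hm; have : m <= m / 2.
      move: (m / 2) hm => z; rewrite /m.
      elim: t {ht hd ut m m0} => [|u t IHt]; rewrite // inE big_cons ge_min.
      by case/orP=> [/eqP -> |/IHt ->]; rewrite ?lexx ?orbT.
    by case: m0 => h1 h2; lra.
  have [| | |s' [us' hs' hin hsub]] := IH (w :: t).
  - by rewrite /= addSn -addnS.
  - by rewrite /= wt.
  - by move=> u; rewrite inE => /orP[/eqP ->|/ht].
  by exists s'; split=> // u hu; apply: hsub; rewrite inE hu orbT.
have [s' [us' hs' hin hsub]] := pad (N - size s)%N s (subnKC hsz) us sL.
exists (sort <=%R s'); split=> [| |u|u /Ps/hsub]; rewrite ?mem_sort //.
- by rewrite sort_lt_sorted.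
- by rewrite size_sort.
- exact: hin.
Qed.

(** * The combinatorics of a subdivision *)

Section Subdivisions.
Variables (G : graph) (n : edge G -> nat).
Local Notation H := (subdivision n).

(** Numbers the vertices of the path replacing [e] from 0 to [n e + 1], old ends included; larger
    indices also give [tgt e]. *)
Definition sub_vertex e (j : nat) : vertex H :=
  if j is j'.+1 then
    if insub j' : option 'I_(n e) is Some w then inr (Tagged (fun e => 'I_(n e)) w)
    else inl (tgt e)
  else inl (src e).

Definition sub_edge e (j : 'I_(n e).+1) : edge H := Tagged (fun e => 'I_(n e).+1) j.

Lemma sub_vertex_last e : sub_vertex e (n e).+1 = inl (tgt e).
Proof. by rewrite /sub_vertex insubF ?ltnn. Qed.

Lemma sub_vertex_inr e (w : 'I_(n e)) : sub_vertex e w.+1 = inr (Tagged (fun e => 'I_(n e)) w).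
Proof. by rewrite /sub_vertex valK. Qed.

Lemma src_sub_edge e (j : 'I_(n e).+1) : src (sub_edge j) = sub_vertex e j.
Proof.
rewrite /src /=; case: unliftP => [k ->|->] //.
by rewrite lift0 sub_vertex_inr.
Qed.

Lemma tgt_sub_edge e (j : 'I_(n e).+1) : tgt (sub_edge j) = sub_vertex e j.+1.
Proof.
rewrite /tgt /=; case: unliftP => [k ->|->]; last exact: esym (sub_vertex_last e).
by rewrite lift_max; exact: esym (@sub_vertex_inr e k).
Qed.

Lemma sub_vertex_inj e i e' j : (0 < i <= n e)%N -> (j <= (n e').+1)%N ->
  sub_vertex e i = sub_vertex e' j -> e = e' /\ i = j.
Proof.
case: i => // i hi; rewrite (sub_vertex_inr (Ordinal hi : 'I_(n e))).
case: j => // j; rewrite ltnS leq_eqVlt => /orP[/eqP->|hj].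
  by rewrite sub_vertex_last.
rewrite (sub_vertex_inr (Ordinal hj)).
move/(congr1 (fun x : vertex H =>
  if x is inr w then (tag w, nat_of_ord (tagged w)) else (e, 0%N))).
by case=> -> ->.
Qed.

Lemma osrc_sub_edge e (j : 'I_(n e).+1) b :
  osrc (sub_edge j, b) = sub_vertex e (if b then j : nat else j.+1).
Proof. by case: b; [exact: src_sub_edge|exact: tgt_sub_edge]. Qed.

Lemma otgt_sub_edge e (j : 'I_(n e).+1) b :
  otgt (sub_edge j, b) = sub_vertex e (if b then j.+1 else j : nat).
Proof. by case: b; [exact: tgt_sub_edge|exact: src_sub_edge]. Qed.

(** Each edge becomes a path of at least three edges, so every new edge has an inner end, which
    determines [e] and its position on the path. *)
Lemma simple_subdivision : (forall e, 1 < n e)%N -> simple_graph H.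
Proof.
move=> n2; split.
  case=> e j; rewrite -/(sub_edge j) src_sub_edge tgt_sub_edge; apply/eqP.
  have := n2 e; have := ltn_ord j; move: (j : nat) => i hi ne.
  case: (posnP i) => [->|i0] h.
    have r1 : (0 < 1 <= n e)%N by apply/andP; split=> //; exact: ltnW.
    by have [] := sub_vertex_inj r1 (leq0n _) (esym h).
  have r1 : (0 < i <= n e)%N by rewrite i0.
  by have [_ /n_Sn] := sub_vertex_inj r1 hi h.
case=> -[e j] b [[e' j'] b'].
rewrite -/(sub_edge j) -/(sub_edge j') !osrc_sub_edge !otgt_sub_edge => h1 h2.
have hj := ltn_ord j; have hj' := ltn_ord j'; have ne := n2 e.
(* On a loop the indices 0 and [n e + 1] name the same vertex, but they are too far apart to be both
   adjacent to [a]. *)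
have vv a c c' : (0 < a <= n e)%N -> (c <= (n e).+1)%N -> (c' <= (n e).+1)%N ->
    (c = a.+1 \/ a = c.+1) -> (c' = a.+1 \/ a = c'.+1) ->
    sub_vertex e c = sub_vertex e c' -> c = c'.
  move=> ha hc hc' ac ac' hv.
  have [ci|ci] := boolP (0 < c <= n e)%N; first by have [] := sub_vertex_inj ci hc' hv.
  have [ci'|ci'] := boolP (0 < c' <= n e)%N; first by have [] := sub_vertex_inj ci' hc (esym hv).
  by move: ci ci'; rewrite !negb_and -!leqNgt -!ltnNge; lia.
suff : e = e' /\ (j = j' :> nat /\ b = b').
  by case=> he; subst e'; case=> /val_inj -> ->.
have main a c a' c' : (a <= (n e).+1)%N -> (c <= (n e).+1)%N ->
    (a' <= (n e').+1)%N -> (c' <= (n e').+1)%N ->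
    (c = a.+1 \/ a = c.+1) -> (c' = a'.+1 \/ a' = c'.+1) ->
    sub_vertex e a = sub_vertex e' a' ->
    sub_vertex e c = sub_vertex e' c' -> [/\ e = e', a = a' & c = c'].
  move=> ha hc ha' hc' ac ac' va vc.
  have [ai|ai] := boolP (0 < a <= n e)%N.
    have [he haa] := sub_vertex_inj ai ha' va; subst e' a'.
    by split=> //; apply: (vv a).
  have ci : (0 < c <= n e)%N.
    by move: ai; rewrite negb_and -leqNgt -ltnNge; lia.
  have [he hcc] := sub_vertex_inj ci hc' vc; subst e' c'.
  by split=> //; apply: (vv c) => //; lia.
have := main _ _ _ _ _ _ _ _ _ _ h1 h2.
case: b h1 h2 => _ _; case: b' => main'.
- by have [||||||he h3 h4] := main'; try lia; split.
- by have [||||||he h3 h4] := main'; try lia; exfalso; lia.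
- by have [||||||he h3 h4] := main'; try lia; exfalso; lia.
- by have [||||||he h3 h4] := main'; try lia; split; last split; rewrite // h4.
Qed.

Lemma connected_subdivision : connected_graph G -> connected_graph H.
Proof.
move=> conn.
pose C := connect [rel x y : vertex H | [exists h : oedge H, (osrc h == x) && (otgt h == y)]].
have Ctrans x y z : C x y -> C y z -> C x z by apply: connect_trans.
have step e j : (j <= n e)%N ->
    C (sub_vertex e j) (sub_vertex e j.+1) /\ C (sub_vertex e j.+1) (sub_vertex e j).
  move=> hj; have hj' : (j < (n e).+1)%N by [].
  split; apply: connect1; apply/existsP.
    by exists (sub_edge (Ordinal hj'), true); rewrite osrc_sub_edge otgt_sub_edge !eqxx.
  by exists (sub_edge (Ordinal hj'), false); rewrite osrc_sub_edge otgt_sub_edge !eqxx.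
have along_e e j : (j <= (n e).+1)%N ->
    C (sub_vertex e 0) (sub_vertex e j) /\ C (sub_vertex e j) (sub_vertex e 0).
  elim: j => [|j IH] hj; first by split; apply: connect0.
  have [h1 h2] := IH (ltnW hj); have [h3 h4] := step e j hj.
  by split; [apply: Ctrans h1 h3|apply: Ctrans h4 h2].
have base_v (u v : vertex G) : C (inl u) (inl v).
  case/connectP: (conn u v) => s; elim: s u => [|a s IH] u /=.
    by move=> _ ->; apply: connect0.
  case/andP=> /existsP[[e b] /andP[/eqP hs /eqP ht]] hp hv.
  apply: Ctrans (IH _ hp hv); rewrite -hs -ht /osrc /otgt /=.
  have [] := along_e e (n e).+1 (leqnn _); rewrite sub_vertex_last /=.
  by case: (b).
have to_v x : exists v, C x (inl v) /\ C (inl v) x.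
  case: x => [v|[e w]]; first by exists v; split; apply: connect0.
  exists (src e); have [h1 h2] := along_e e w.+1 (ltnW (ltn_ord w)).
  by rewrite sub_vertex_inr in h1 h2.
move=> x y; have [u [h1 _]] := to_v x; have [v [_ h2]] := to_v y.
exact: Ctrans h1 (Ctrans _ _ _ (base_v u v) h2).
Qed.

End Subdivisions.

(** * A placed subdivision is a model *)

Section PlacedMap.
Variables (R : realType) (G : graph) (l : edge G -> R) (n : edge G -> nat).
Hypothesis hl : metric_graph l.
Variable t : edge G -> nat -> R.
Hypothesis ht : placement l n t.

Let l_gt0 : forall e, 0 < l e.
Proof. by case: hl. Qed.

Local Notation H := (subdivision n).
Local Notation lH := (placed_length (n := n) t).
Local Notation phi := (placed_map l n t).

Lemma placed_lengthE e (j : 'I_(n e).+1) : lH (sub_edge j) = t e j.+1 - t e j.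
Proof. by []. Qed.

Lemma placed_length_gt0 f : 0 < lH f.
Proof.
by case: f => e j; rewrite (placed_lengthE j) subr_gt0; have [_ _ h] := ht e; apply: h.
Qed.

Let lH_gt0 := placed_length_gt0.

Lemma knot_ge0 e (j : nat) : (j <= (n e).+1)%N -> 0 <= t e j.
Proof. by move=> hj; have [<- _ _] := ht e; apply: (knots_le (ht e)). Qed.

Lemma knot_le e (j : nat) : (j <= (n e).+1)%N -> t e j <= l e.
Proof.
by move=> hj; have [_ <- _] := ht e; apply: (knots_le (ht e)); rewrite hj /=.
Qed.

Lemma knot_lt e (i j : nat) : (i < j)%N -> (j <= (n e).+1)%N -> t e i < t e j.
Proof.
move=> ij hj; have [_ _ h] := ht e.
apply: lt_le_trans (h i (leq_trans ij hj)) _.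
by apply: (knots_le (ht e)); rewrite ij.
Qed.

Lemma placed_sub_vertex e j : (j <= (n e).+1)%N -> phi (inl (sub_vertex n e j)) = pt l e (t e j).
Proof.
have [t0 tn _] := ht e.
case: j => [|j] hj; first by rewrite t0 pt_src.
move: hj; rewrite ltnS leq_eqVlt => /orP[/eqP ->|hj].
  by rewrite sub_vertex_last tn (pt_tgt l_gt0).
by have -> : j.+1 = (Ordinal hj).+1 by []; rewrite sub_vertex_inr.
Qed.

Lemma placed_pt e (j : 'I_(n e).+1) a : 0 <= a <= lH (sub_edge j) ->
  phi (pt lH (sub_edge j) a) = pt l e (t e j + a).
Proof.
have hj := ltn_ord j.
case/pt_cases=> [->|->|ha].
- by rewrite pt_src src_sub_edge placed_sub_vertex ?addr0 // ltnW.
- by rewrite (pt_tgt lH_gt0) tgt_sub_edge placed_sub_vertex // placed_lengthE subrKC.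
- by rewrite (pt_interior ha).
Qed.

(** Half-open cells give a unique description: a new vertex belongs to the edge that starts at it,
    and the last condition excludes the source of [e]. Injectivity is read off from this. *)
Lemma placed_interior_cases (y : realization lH) :
  (exists v, y = inl (inl v)) \/
  exists e (j : 'I_(n e).+1) a,
    [/\ y = pt lH (sub_edge j) a, 0 <= a < lH (sub_edge j) & 0 < t e j + a].
Proof.
case: y => [[v|[e w]]|p].
- by left; exists v.
- right; have hw : (w.+1 < (n e).+1)%N by rewrite ltnS.
  exists e, (Ordinal hw), 0; rewrite lexx lH_gt0 addr0; split=> //.
    by rewrite pt_src src_sub_edge; congr inl; rewrite -sub_vertex_inr.
  by have [<- _ _] := ht e; apply: knot_lt; rewrite // ltnW.
- right; case hp: (val p) (valP p) (inr_pt p) => [[e j] a] /= /andP[a0 al] hpt.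
  exists e, j, a; split=> //; first by rewrite (ltW a0) al.
  have : 0 <= t e j by rewrite knot_ge0 // ltnW.
  by move=> h; apply: lt_le_trans a0 _; rewrite lerDr.
Qed.

Lemma cell_range e (j : 'I_(n e).+1) a : 0 <= a <= lH (sub_edge j) ->
  0 <= t e j + a <= l e.
Proof.
rewrite placed_lengthE => /andP[a0 a1]; have hj := ltn_ord j.
have := knot_ge0 (ltnW hj); have := knot_le hj => h1 h2.
by apply/andP; split; lra.
Qed.

Lemma placed_inj : injective phi.
Proof.
have inner e (j : 'I_(n e).+1) a : 0 <= a < lH (sub_edge j) -> 0 < t e j + a ->
    0 < t e j + a < l e.
  move=> /andP[a0 al] -> /=; have hj := ltn_ord j.
  apply: lt_le_trans (knot_le hj); by rewrite placed_lengthE in al; lra.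
have noinl e (j : 'I_(n e).+1) a v : 0 <= a < lH (sub_edge j) -> 0 < t e j + a ->
    phi (pt lH (sub_edge j) a) <> inl v.
  move=> ha hp; rewrite placed_pt; last by case/andP: ha => -> /ltW.
  by rewrite (pt_interior (inner _ _ _ ha hp)).
move=> y y'; case: (placed_interior_cases y) => [[v ->]|[e [j [a [-> ha hp]]]]];
  case: (placed_interior_cases y') => [[v' ->]|[e' [j' [a' [-> ha' hp']]]]] //=.
- by case=> ->.
- by move/esym/(noinl _ _ _ _ ha' hp').
- by move/(noinl _ _ _ _ ha hp).
have la : 0 <= a <= lH (sub_edge j) by case/andP: ha => -> /ltW.
have la' : 0 <= a' <= lH (sub_edge j') by case/andP: ha' => -> /ltW.
rewrite !placed_pt //.
case/(pt_inj l_gt0 (inner _ _ _ ha hp) (cell_range la')) => he; subst e'.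
move: ha ha'; rewrite !placed_lengthE => /andP[a0 a1] /andP[a0' a1'] heq.
have jj : j = j'.
  have hj := ltn_ord j; have hj' := ltn_ord j'.
  case: (ltngtP j j') => [hlt|hlt|/val_inj //]; exfalso.
    have : t e j.+1 <= t e j' by apply: (knots_le (ht e)); rewrite hlt ltnW.
    move: a0' a1 heq; clear; lra.
  have : t e j'.+1 <= t e j by apply: (knots_le (ht e)); rewrite hlt ltnW.
  move: a0 a1' heq; clear; lra.
by subst j'; congr pt; lra.
Qed.

Lemma find_cell e u : 0 <= u <= l e -> exists (j : 'I_(n e).+1) a,
  0 <= a <= lH (sub_edge j) /\ u = t e j + a.
Proof.
have [t0 tn _] := ht e; case/andP => u0; rewrite le_eqVlt => /orP[/eqP ->|ul].
  exists ord_max, (lH (sub_edge (@ord_max (n e)))); rewrite ltW ?lH_gt0 // lexx.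
  by split=> //; rewrite placed_lengthE subrKC.
have [|i hi /andP[h1 h2]] := knots_find (ht e) (u := u); first by rewrite u0.
exists (Ordinal hi), (u - t e i); rewrite placed_lengthE /=; split; last by lra.
by apply/andP; split; lra.
Qed.

Lemma placed_surj x : exists y, phi y = x.
Proof.
case: x => [v|p]; first by exists (inl (inl v)).
have /andP[/ltW h1 /ltW h2] := valP p.
have [|j [a [ha hu]]] := @find_cell (val p).1 (val p).2; first by rewrite h1.
by exists (pt lH (sub_edge j) a); rewrite placed_pt // -hu -inr_pt.
Qed.

Lemma walk_placed y y' L : walk y y' L -> walk (phi y) (phi y') L.
Proof.
elim=> {y y' L} [y|y y' [e j] a b L ha hb -> _ w]; first exact: walk_nil.
have -> : `|a - b| = `|(t e j + a) - (t e j + b)| by congr `|_|; lra.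
apply: walk_cons (cell_range ha) (cell_range hb) (placed_pt ha) _.
by rewrite -(placed_pt hb).
Qed.

(** A segment of [e] may cross several knots, so it is cut at them and each part is lifted inside a
    single cell. *)
Lemma walk_lift_step e a b y y' : 0 <= a <= l e -> 0 <= b <= l e ->
  phi y = pt l e a -> phi y' = pt l e b -> walk y y' `|a - b|.
Proof.
wlog ab : a b y y' / a <= b.
  move=> hwlog ha hb hy hy'; have [ab|/ltW ba] := leP a b; first exact: hwlog.
  by rewrite distrC; apply: walk_sym; apply: hwlog.
have cell (j : 'I_(n e).+1) a' b' z z' : t e j <= a' -> a' <= b' -> b' <= t e j.+1 ->
    phi z = pt l e a' -> phi z' = pt l e b' -> walk z z' `|a' - b'|.
  move=> h1 h2 h3 hz hz'.
  have ra : 0 <= a' - t e j <= lH (sub_edge j).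
    by rewrite placed_lengthE; apply/andP; split; lra.
  have rb : 0 <= b' - t e j <= lH (sub_edge j).
    by rewrite placed_lengthE; apply/andP; split; lra.
  have -> : z = pt lH (sub_edge j) (a' - t e j).
    by apply: placed_inj; rewrite placed_pt // hz; congr pt; lra.
  have -> : z' = pt lH (sub_edge j) (b' - t e j).
    by apply: placed_inj; rewrite placed_pt // hz'; congr pt; lra.
  have -> : `|a' - b'| = `|(a' - t e j) - (b' - t e j)| by congr `|_|; lra.
  exact: walk_step.
have [t0 tn _] := ht e.
move=> /andP[a0 _] /andP[_ bl] hy hy'.
(* Induction on the index of a knot to the right of the endpoint; the last knot is [l e]. *)
suff main k c z : (k <= (n e).+1)%N -> c <= t e k -> a <= c ->
    phi z = pt l e c -> walk y z `|a - c|.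
  by apply: (main (n e).+1) => //; rewrite tn.
elim: k c z {b ab y' hy' bl} => [|k IH] b y' hk bk ab hy'.
  rewrite t0 in bk.
  have ea : a = 0 by apply: le_anti; rewrite a0 (le_trans ab).
  have eb : b = 0 by apply: le_anti; rewrite bk (le_trans a0).
  rewrite ea eb subrr normr0 in hy hy' *.
  have -> : y = y' by apply: placed_inj; rewrite hy.
  exact: walk_nil.
have [bk'|/ltW kb] := leP b (t e k); first by apply: (IH _ _ (ltnW hk)).
have [ka|/ltW ak] := leP (t e k) a; first by apply: (cell (Ordinal hk)).
have [z hz] := placed_surj (pt l e (t e k)).
have -> : `|a - b| = `|a - t e k| + `|t e k - b| by rewrite !ler0_norm; lra.
apply: walk_cat (IH _ _ (ltnW hk) (lexx _) ak hz) _.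
exact: (cell (Ordinal hk)).
Qed.

(** Together with [walk_placed], this shows that both metrics are infima of the same set of
    lengths. *)
Lemma walk_lift y y' L : walk (phi y) (phi y') L -> walk y y' L.
Proof.
move: {-2}(phi y) {-2}(phi y') (erefl (phi y)) (erefl (phi y')) => x x' hx hx' w.
elim: w y hx hx' => {x x' L} [x|x x' e a b L ha hb hxa _ IH] y hx hx'.
  have -> : y = y' by apply: placed_inj; rewrite -hx hx'.
  exact: walk_nil.
have [z hz] := placed_surj (pt l e b).
apply: walk_cat (IH z (esym hz) hx'); apply: (walk_lift_step ha hb) => //.
by rewrite -hx.
Qed.

Lemma placed_is_model : is_model phi.
Proof.
split.
- case: hl => conn [e] _; split; [exact: connected_subdivision| |exact: lH_gt0].
  by constructor; exact: (sub_edge (ord0 : 'I_(n e).+1)).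
- have [psi psiK] := choice placed_surj.
  by exists psi => // y; apply: placed_inj; rewrite psiK.
- move=> y y'; rewrite /dist; congr inf; apply/seteqP; split=> L /=.
    exact: walk_lift.
  exact: walk_placed.
Qed.

Lemma placed_par e (j : 'I_(n e).+1) b (y : realization lH) :
  outgoing y (sub_edge j, b) ->
  [/\ valid l e (t e j + base y (sub_edge j, b)) b,
      valid lH (sub_edge j) (base y (sub_edge j, b)) b,
      phi y = pt l e (t e j + base y (sub_edge j, b)) &
      par phi y (sub_edge j, b) (e, b)].
Proof.
move=> hy; have [hv hyp] := outgoing_base lH_gt0 hy.
move: hv hyp; set w := base _ _ => /= hv hyp.
have hw := valid_le hv.
have hphi : phi y = pt l e (t e j + w) by rewrite {1}hyp placed_pt.
have hj := ltn_ord j.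
have hv' : valid l e (t e j + w) b.
  have := knot_ge0 (ltnW hj); have := knot_le hj => h1 h2.
  move: hv; rewrite /valid placed_lengthE.
  by case: (b) => /andP[h3 h4]; apply/andP; split; lra.
split=> //; exists (if b then lH (sub_edge j) - w else w).
  by move: hv; rewrite /valid; case: (b) => /andP[h1 h2]; rewrite ?subr_gt0.
move=> s /andP[s0 s1]; rewrite goE /= -/w hphi (go_pt l_gt0) // placed_pt.
  by congr pt; rewrite /shift; case: (b); rewrite addrA.
by move/andP: hw s1 => [h1 h2]; rewrite /shift; case: (b) => s1; apply/andP; split; lra.
Qed.

End PlacedMap.

(** * Finiteness of bounded slope structures *)

Lemma finitely_many_slope_structures (r : nat) (H : graph) (B : nat) :
  exists (k : nat) (S : 'I_k -> slope_structure r H),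
    forall S' : slope_structure r H, (forall h i, `|slopes S' h i| <= B%:Z) ->
    exists j, (forall h i, slopes (S j) h i = slopes S' h i) /\
      forall v b, rank (S j) (v := v) b = rank S' (v := v) b.
Proof.
pose dom := {v : vertex H & {ffun star v -> 'I_r.+1}}.
(* Slopes in [[-B, B]] are shifted by [B] and ranks in [[-1, r]] by 1, so [inord] loses nothing on
   bounded structures. *)
pose code := ({ffun oedge H * 'I_r.+1 -> 'I_(B + B).+1} * {ffun dom -> 'I_r.+2})%type.
pose enc (S : slope_structure r H) : code :=
  ([ffun p => inord (absz (slopes S p.1 p.2 + B%:Z))],
   [ffun d : dom => inord (absz (rank S (v := tag d) (tagged d) + 1))]).
pose bounded (S : slope_structure r H) := forall h i, `|slopes S h i| <= B%:Z.
have enc_inj S S' : bounded S -> bounded S' -> enc S = enc S' ->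
    (forall h i, slopes S h i = slopes S' h i) /\
    forall v b, rank S (v := v) b = rank S' (v := v) b.
  move=> hS hS' [/ffunP e1 /ffunP e2]; split=> [h i|v b].
    have := e1 (h, i); rewrite !ffunE /= => /(congr1 val) /=.
    have := hS h i; have := hS' h i; rewrite !ler_norml => h1 h2.
    by rewrite !inordK; lia.
  have := e2 (Tagged (fun v => {ffun star v -> 'I_r.+1}) b).
  rewrite !ffunE /= => /(congr1 val) /=.
  have rk (T : slope_structure r H) : -1 <= rank T b <= r%:Z.
    by case: T => sl rho h1 h2 h3 hrho /=; have [_ _ _] := hrho v; apply.
  have := rk S; have := rk S'.
  move: (rank S b) (rank S' b) => x y; clear => h1 h2.
  by rewrite !inordK; lia.
(* One representative is kept for each code that a bounded structure attains. *)
pose A := [set c : code | `[< exists2 S, bounded S & enc S = c >]].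
have hA (j : 'I_#|A|) : exists S, bounded S /\ enc S = enum_val j.
  by have := enum_valP j; rewrite inE => /asboolP[S hS hc]; exists S.
have [S hS] := choice hA.
exists #|A|, S => S' hS'.
have hc : enc S' \in A by rewrite inE; apply/asboolP; exists S'.
exists (enum_rank_in hc (enc S')); have [h1 h2] := hS (enum_rank_in hc (enc S')).
by apply: enc_inj => //; rewrite h2 enum_rankK_in.
Qed.

Lemma induced_ext (R : realType) (G H : graph) (l : edge G -> R) (lH : edge H -> R)
    (phi : realization lH -> realization l) r (S S' : slope_structure r H)
    (SS : slope_data l r) :
  (forall h i, slopes S h i = slopes S' h i) ->
  (forall v b, rank S (v := v) b = rank S' (v := v) b) ->
  induced phi S' SS -> induced phi S SS.
Proof.
move=> h1 h2 [i1 i2 i3]; split=> // [y h nu hp i|v a b hab].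
  by rewrite h1; apply: i1.
by rewrite h2; apply: i2.
Qed.

(** * The structure induced on the subdivision *)

Section InducedStructure.
Variables (R : realType) (G : graph) (l : edge G -> R).
Hypothesis hl : metric_graph l.
Variable D : divisor l.
Hypothesis hD : supported_on_vertices D.
Variables (r : nat) (SS : slope_data l r) (M : set (realization l -> R)).
Hypothesis hM : admissible D SS M.
Variables (n : edge G -> nat) (t : edge G -> nat -> R).
Hypothesis n_gt1 : forall e, (1 < n e)%N.
Hypothesis ht : placement l n t.
Hypothesis break_knot : forall e u, break_point SS e u ->
  exists2 j, (j <= (n e).+1)%N & u = t e j.

Let l_gt0 : forall e, 0 < l e.
Proof. by case: hl. Qed.

Local Notation H := (subdivision n).
Local Notation phi := (placed_map l n t).

Lemma no_break_in_cell e (j : 'I_(n e).+1) u :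
  t e j < u < t e j.+1 -> ~ break_point SS e u.
Proof.
move=> /andP[h1 h2] /break_knot[i hi hu]; rewrite {}hu in h1 h2.
have [ij|ji] := leqP i j.
  have : t e i <= t e j by apply: (knots_le (ht e)); rewrite ij ltnW.
  by rewrite leNgt h1.
have : t e j.+1 <= t e i by apply: (knots_le (ht e)); rewrite ji.
by rewrite leNgt h2.
Qed.

Lemma left_slopes_cell e (j : 'I_(n e).+1) u i : t e j < u <= t e j.+1 ->
  left_slopes SS e u i = right_slopes SS e (t e j) i.
Proof.
move=> /andP[h1 h2]; have hj := ltn_ord j.
have h3 := knot_ge0 ht (ltnW hj); have h4 := knot_le ht hj.
apply: (slopes_constant hl hM) => // [|w /andP[w1 w2]]; first exact: le_trans h4.
by apply: (@no_break_in_cell _ j); rewrite w1 (lt_le_trans w2).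
Qed.

Lemma regular_in_cell e (j : 'I_(n e).+1) u i : t e j < u < t e j.+1 ->
  0 < u < l e /\ right_slopes SS e u i = left_slopes SS e u i.
Proof.
move=> hu; have /andP[h1 h2] := hu; have hj := ltn_ord j.
have h3 := knot_ge0 ht (ltnW hj); have h4 := knot_le ht hj.
have hul : 0 < u < l e by rewrite (le_lt_trans h3 h1) (lt_le_trans h2 h4).
split=> //; apply/eqP/negPn/negP => hne; apply: (no_break_in_cell hu).
by split=> //; exists i => heq; rewrite heq eqxx in hne.
Qed.

Lemma right_slopes_cell e (j : 'I_(n e).+1) u i : t e j <= u < t e j.+1 ->
  right_slopes SS e u i = right_slopes SS e (t e j) i.
Proof.
move=> /andP[]; rewrite le_eqVlt => /orP[/eqP <- //|h1 h2].
have [|_ ->] := @regular_in_cell e j u i; first by rewrite h1.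
by apply: left_slopes_cell; rewrite h1 ltW.
Qed.

(** The slopes are sampled at the left end of the cell; they persist through it because no break
    point lies inside. *)
Definition cell_slopes (h : oedge H) (i : 'I_r.+1) : int :=
  let u := t (tag h.1) (tagged h.1) in
  if h.2 then right_slopes SS (tag h.1) u i else - right_slopes SS (tag h.1) u (rev_ord i).

Lemma slopes_along_cell e (j : 'I_(n e).+1) b w i :
  valid (placed_length (n := n) t) (sub_edge j) w b ->
  slopes_along SS (pt l e (t e j + w)) (e, b) i = cell_slopes (sub_edge j, b) i.
Proof.
rewrite /valid placed_lengthE /cell_slopes /=; case: b => /andP[h1 h2].
  by rewrite -(@right_slopes_cell _ j (t e j + w)) //; apply/andP; split; lra.
rewrite -(@left_slopes_cell _ j (t e j + w)); last by apply/andP; split; lra.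
by rewrite /left_slopes opprK rev_ordK.
Qed.

Lemma cell_slopes_outgoing e (j : 'I_(n e).+1) : outgoing (pt l e (t e j)) (e, true).
Proof.
have hj := ltn_ord j.
have hv : valid l e (t e j) true.
  rewrite /valid (knot_ge0 ht (ltnW hj)) /=.
  by apply: lt_le_trans (knot_le ht hj); apply: (knot_lt ht).
by have [] := base_pt l_gt0 hv.
Qed.

Lemma induced_slope_structure : exists2 S : slope_structure r H,
  induced phi S SS & forall h i, `|slopes S h i| <= slope_bound D.
Proof.
have hphi := placed_is_model hl ht.
have [_ _ phi_dist] := hphi.
have tau (v : vertex H) : {sig : tangent (phi (inl v)) -> star v |
    bijective sig /\ forall nu, parallel (y := inl v) (sig nu) nu}.
  apply: cid; have [f [[g fK gK] fP]] := tangent_bijection hl hphi (inl v).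
  exists g; split; first by exists f.
  by move=> nu; apply/fP; rewrite gK.
(* The rank function at [phi v] is transported along the bijection of directions, since [star v] and
   the tangent vectors at [phi v] are different types. *)
pose rk (v : vertex H) (b : {ffun star v -> 'I_r.+1}) : int :=
  mrank SS (x := phi (inl v)) [ffun nu => b (sval (tau v) nu)].
have incr (h : oedge H) (i j : 'I_r.+1) : (i < j)%N -> cell_slopes h i < cell_slopes h j.
  case: h => [[e k] b] ij; have ho := @cell_slopes_outgoing e k.
  rewrite /cell_slopes /=; case: b; first exact: (slopes_along_lt hl hM ho).
  rewrite ltrN2; apply: (slopes_along_lt hl hM ho).
  by rewrite /= ltn_sub2l // ltnS (leq_trans ij) // -ltnS.
have opp (h : oedge H) i : cell_slopes h i + cell_slopes (orev h) (rev_ord i) = 0.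
  case: h => [[e k] b]; rewrite /cell_slopes /orev /=.
  by case: b => /=; rewrite ?rev_ordK ?subrr ?addNr.
have hrk v : rank_function (rk v).
  case: (svalP (tau v)) => hbij _.
  exact: (rank_function_reindex hbij (mrank_rank_function hl hM _)).
exists (SlopeStructure (simple_subdivision n_gt1) incr opp hrk); last first.
  move=> [[e k] b] i /=; have ho := @cell_slopes_outgoing e k.
  rewrite /cell_slopes /=; case: b; rewrite ?normrN;
    exact: (slopes_along_bounded hl hD hM _ ho).
split=> /=.
- move=> y [[[e k] b] ho] nu hp i /=.
  have [hv hw hy hpar] := placed_par hl ht (j := k) ho.
  have hk : outgoing (phi y) (e, b) by rewrite hy; case: (base_pt l_gt0 hv).
  have hnu : val nu = (e, b) by apply: (par_unique hl (valP nu) hk hp hpar).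
  rewrite slopes_alongE hnu hy; exact: slopes_along_cell.
- move=> v a b hab; rewrite /rk; congr (mrank SS _); apply/ffunP => nu.
  by rewrite ffunE; apply: hab; case: (svalP (tau v)).
- case=> -[[e k] s] hs /=; have /andP[s0 s1] := hs.
  have {}s0 : 0 < s := s0; have {}s1 : s < t e k.+1 - t e k := s1.
  have hw : t e k < t e k + s < t e k.+1 by apply/andP; split; lra.
  apply: (rank_standard_at hl hD hM) => [|i].
    by have [] := regular_in_cell ord0 hw.
  by have [] := regular_in_cell i hw.
Qed.

End InducedStructure.

Lemma knots_of_sorted (R : realType) (L : R) (s : seq R) : 0 < L -> sorted <%R s ->
  (forall u, u \in s -> 0 < u < L) -> knots 0 L (size s).+1 (nth 0 (0 :: rcons s L)).
Proof.
move=> L0 hs hin; split=> //; first by rewrite /= nth_rcons ltnn eqxx.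
have hsort : sorted <%R (0 :: rcons s L).
  case: s hs hin => [|u s] /=; first by rewrite L0.
  move=> hp hin; have /andP[-> _] /= := hin u (mem_head _ _).
  rewrite rcons_path hp /=; have /andP[] := hin (last u s) (mem_last _ _).
  by [].
move=> i hi; apply: (sorted_ltn_nth lt_trans 0 hsort) => //;
  by rewrite inE /= size_rcons ltnS // ltnW.
Qed.
Theorem theorem1p4 (R : realType) (G : graph) (l : edge G -> R)
    (hG : metric_graph l) (D : divisor l) (hD : supported_on_vertices D)
    (r : nat) :
  exists (k : nat) (n : 'I_k -> edge G -> nat)
         (S : forall j : 'I_k, slope_structure r (subdivision (n j))),
    forall (M : set (realization l -> R)) (SS : slope_data l r),
      admissible D SS M ->
      exists (j : 'I_k) (t : edge G -> nat -> R),
        [/\ placement l (n j) t,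
            is_model (placed_map l (n j) t)
          & induced (placed_map l (n j) t) (S j) SS].
Proof.
(* [N] does not depend on the semimodule, and it is at least 2 so that the subdivision is simple. *)
pose N := (break_bound D r).+2.
have [k [S hS]] := finitely_many_slope_structures r
  (subdivision (fun _ : edge G => N)) (absz (slope_bound D)).
exists k, (fun _ _ => N), S => M SS hM.
have l_gt0 : forall e, 0 < l e by case: hG.
have marks e : exists s : seq R, [/\ sorted <%R s, size s = N,
    forall u, u \in s -> 0 < u < l e & forall u, break_point SS e u -> u \in s].
  apply: (exists_marking (K := break_bound D r)) => //.
  - by move=> u [].
  - by rewrite /N; lia.
  - exact: (break_points_bounded hG hD hM).
have [s hs] := choice marks.
pose t e := nth 0 (0 :: rcons (s e) (l e)).
have ht : placement l (fun _ => N) t.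
  by move=> e; have [h1 <- h3 _] := hs e; apply: knots_of_sorted.
have break_knot e u : break_point SS e u -> exists2 j, (j <= N.+1)%N & u = t e j.
  have [_ hsz _ h] := hs e => /h hu.
  (* The shift by one accounts for the knot 0 in front of the marked points. *)
  exists (index u (s e)).+1; first by rewrite ltnS -hsz index_size.
  by rewrite /t /= nth_rcons index_mem hu nth_index.
have [//|S' hind hbound] := induced_slope_structure hG hD hM _ ht break_knot.
have [|j [h1 h2]] := hS S'.
  by move=> h i; apply: le_trans (hbound h i) _; rewrite lez_abs.
exists j, t; split=> //; first exact: placed_is_model.
exact: induced_ext h1 h2 hind.
Qed.
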